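(* Let $K$ be a field, let $R,C\ge 1$ be integers, let $\mathcal{I}=\{(i,j)\mid 1\le i\le R,\ 1\le j\le C\}$, and let $S_1,\ldots,S_N$ ($N\ge1$) be rectangles of $\mathcal{I}$ with $S_1\subset S_2\subset\cdots\subset S_N\subset\mathcal{I}$. Let $I_{S_1,\ldots,S_N}$ be the associated toric ideal and $R_{S_1,\ldots,S_N}$ the associated semigroup ring. Then: (i) $I_{S_1,\ldots,S_N}$ possesses a quadratic Gröbner basis; (ii) $I_{S_1,\ldots,S_N}$ possesses a square-free initial ideal; (iii) $R_{S_1,\ldots,S_N}$ is normal; (iv) $R_{S_1,\ldots,S_N}$ is Koszul.
   Context: The symbol $\subset$ denotes proper inclusion. A subset $S\subseteq\mathcal{I}$ is a rectangle in $\mathcal{I}$ if $S=\{(i,j)\mid a_1\le i\le a_2,\ b_1\le j\le b_2\}$ for some $1\le a_1<a_2\le R$ and $1\le b_1<b_2\le C$. Put $S_0=\emptyset$ and $S_{N+1}=\mathcal{I}$. Let $K[\{u_i\}_{1\le i\le R}\cup\{v_j\}_{1\le j\le C}\cup\{w_n\}_{1\le n\le N+1}]$ be a polynomial ring over $K$. To each cell $(i,j)\in S_n\setminus S_{n-1}$, $1\le n\le N+1$, associate the monomial $u_iv_jw_n$. The semigroup ring $R_{S_1,\ldots,S_N}$ is the $K$-subalgebra generated by these monomials, one for each $(i,j)\in\mathcal{I}$, graded so that these generators have degree $1$. Let $K[\mathbf{x}]=K[\{x_{ij}\}_{(i,j)\in\mathcal{I}}]$ be the polynomial ring in $RC$ variables,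 and let $\pi:K[\mathbf{x}]\to R_{S_1,\ldots,S_N}$ be the surjective $K$-algebra homomorphism with $\pi(x_{ij})=u_iv_jw_n$ for $(i,j)\in S_n\setminus S_{n-1}$. The toric ideal is $I_{S_1,\ldots,S_N}=\ker\pi$. ''Possesses a quadratic Gröbner basis'' means that with respect to some monomial order there is a Gröbner basis consisting of polynomials of degree two. ''Possesses a square-free initial ideal'' means that with respect to some monomial order the initial ideal is generated by square-free monomials. *)

(* Defs.v *)
From HB Require Import structures.
From mathcomp Require Import all_boot all_order all_algebra.
From mathcomp.classical Require Import boolp.
From mathcomp.multinomials Require Import mpoly.

Set Implicit Arguments.
Unset Strict Implicit.
Unset Printing Implicit Defensive.

Import Order.TTheory GRing.Theory.
Local Open Scope ring_scope.

Section Groebner.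
Context (K : fieldType) (n : nat).
Implicit Types (le : rel 'X_{1..n}) (I : {mpoly K[n]} -> Prop).

(* By Dickson's lemma such an order is automatically a well-order. *)
Definition monomial_order le : Prop :=
  [/\ total le, antisymmetric le, transitive le,
      (forall m, le 0%MM m)
    & (forall m m1 m2, le m1 m2 -> le (m1 + m)%MM (m2 + m)%MM)].

(* [m] is the initial monomial of [p]; there is none when [p = 0]. *)
Definition initial_monomial le (p : {mpoly K[n]}) (m : 'X_{1..n}) : Prop :=
  m \in msupp p /\ (forall m', m' \in msupp p -> le m' m).

Definition generated_ideal (F : {mpoly K[n]} -> Prop) (p : {mpoly K[n]}) : Prop :=
  exists2 s : seq ({mpoly K[n]} * {mpoly K[n]}),
    (forall x, x \in s -> F x.2) & p = \sum_(x <- s) x.1 * x.2.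

Definition initial_ideal le (F : {mpoly K[n]} -> Prop) : {mpoly K[n]} -> Prop :=
  generated_ideal (fun q => exists f m,
    [/\ F f, initial_monomial le f m & q = 'X_[m]]).

Definition groebner_basis le I (G : seq {mpoly K[n]}) : Prop :=
  (forall g, g \in G -> I g) /\
  (forall p, initial_ideal le (fun g => g \in G) p <-> initial_ideal le I p).

(* [msize] is one more than the total degree. *)
Definition has_quadratic_groebner_basis I : Prop :=
  exists le G, [/\ monomial_order le, groebner_basis le I G
                 & forall g, g \in G -> msize g = 3%N].

Definition squarefree (m : 'X_{1..n}) : Prop := forall i, (m i <= 1)%N.

Definition has_squarefree_initial_ideal I : Prop :=
  exists le (B : 'X_{1..n} -> Prop),
    [/\ monomial_order le, (forall m, B m -> squarefree m)
      & forall p, initial_ideal le I p <->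
                  generated_ideal (fun q => exists2 m, B m & q = 'X_[m]) p].

End Groebner.

Definition normal_domain (A : idomainType) : Prop :=
  forall u : {fraction A}, integralOver (@tofrac A) u -> exists a : A, u = tofrac a.

(* Koszulness of a graded ring [A] whose component of degree [d] is [gr d]. *)

Section Koszul.
Context (A : comNzRingType) (gr : nat -> A -> Prop).

Definition irrelevant_ideal (a : A) : Prop :=
  exists k (f : nat -> A), (forall i, gr i.+1 (f i)) /\ a = \sum_(i < k) f i.

(* A linear graded free resolution
     ... -> A(-2)^(b 2) -> A(-1)^(b 1) -> A -> A / A_+ -> 0,
   the maps being [v |-> v *m d i] on row vectors.  The ranks are finite, as
   they are in the minimal resolution over a Noetherian ring. *)
Definition koszul : Prop :=
  exists (b : nat -> nat) (d : forall i, 'M[A]_(b i.+1, b i)),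
    [/\ b 0%N = 1%N,
        (forall i r c, gr 1%N (d i r c)),
        (forall v : 'rV[A]_(b 0%N),
           (exists w, v = w *m d 0%N) <-> (forall j, irrelevant_ideal (v 0 j)))
      & (forall i (v : 'rV[A]_(b i.+1)),
           v *m d i = 0 <-> (exists w, v = w *m d i.+1))].

End Koszul.

Section GeneratedSubalgebra.
Context (K : fieldType) (n m : nat) (g : m.-tuple {mpoly K[n]}).

Definition in_subalgebra : {pred {mpoly K[n]}} :=
  fun p => `[< exists q : {mpoly K[m]}, p = q \mPo g >].

Record subalgebra := Subalgebra {
  subalgebra_val :> {mpoly K[n]};
  subalgebra_valP : subalgebra_val \in in_subalgebra }.

HB.instance Definition _ := [isSub for subalgebra_val].
HB.instance Definition _ := [Choice of subalgebra by <:].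

(* In [{mpoly K[n]}] the inverse of a non-unit is itself by convention, and the
   units are the nonzero constants, so every K-subalgebra is closed under
   division in the sense of MathComp. *)
Lemma in_subalgebra_divring : divring_closed in_subalgebra.
Proof.
have mulP p1 p2 : p1 \in in_subalgebra -> p2 \in in_subalgebra ->
    p1 * p2 \in in_subalgebra.
  move=> /asboolP[q1 ->] /asboolP[q2 ->]; apply/asboolP.
  by exists (q1 * q2); rewrite rmorphM.
split=> [|p1 p2|p1 p2 p1A p2A].
- by apply/asboolP; exists 1; rewrite rmorph1.
- move=> /asboolP[q1 ->] /asboolP[q2 ->]; apply/asboolP.
  by exists (q1 - q2); rewrite rmorphB.
- apply: mulP => //; have [p2U|p2U] := boolP (p2 \is a GRing.unit); last first.
    by rewrite invr_out.
  apply/asboolP; exists (p2@_0)^-1%:MP_[m].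
  move: p2U => /andP[/eqP p2E p0U].
  have p2M : p2 * (p2@_0)^-1%:MP = 1 by rewrite {1}p2E -mpolyCM divrr.
  have p2U : p2 \is a GRing.unit by apply/andP; split; first exact/eqP.
  by rewrite comp_mpolyC; apply: (mulrI p2U); rewrite divrr // p2M.
Qed.

HB.instance Definition _ :=
  GRing.isDivringClosed.Build {mpoly K[n]} in_subalgebra in_subalgebra_divring.
HB.instance Definition _ := [SubChoice_isSubComUnitRing of subalgebra by <:].
HB.instance Definition _ := [SubComUnitRing_isSubIntegralDomain of subalgebra by <:].

End GeneratedSubalgebra.

Section NestedRectangles.
Context (K : fieldType) (R C N : nat).
Implicit Type S : N.-tuple {set 'I_R * 'I_C}.

(* Rows, columns and the variables w are numbered from 0. *)

Definition rectangle (A : {set 'I_R * 'I_C}) : Prop :=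
  exists (a1 a2 : 'I_R) (b1 b2 : 'I_C),
    [/\ (a1 < a2)%N, (b1 < b2)%N
      & A = [set c : 'I_R * 'I_C | (a1 <= c.1 <= a2)%N && (b1 <= c.2 <= b2)%N]].

(* S_0 = set0, S_1, ..., S_N, S_(N+1) = setT; the tuple holds S_1, ..., S_N. *)
Definition chain S (k : nat) : {set 'I_R * 'I_C} := nth setT (set0 :: S) k.

(* The unique [k] such that [c] lies in S_(k+1) but not in S_k
   (the default value is never reached). *)
Definition layer S (c : 'I_R * 'I_C) : 'I_N.+1 :=
  odflt ord0 [pick k : 'I_N.+1 | c \in chain S k.+1 :\: chain S k].

Definition var_u (i : 'I_R) : {mpoly K[R + C + N.+1]} := 'X_(lshift N.+1 (lshift C i)).
Definition var_v (j : 'I_C) : {mpoly K[R + C + N.+1]} := 'X_(lshift N.+1 (rshift R j)).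
Definition var_w (k : 'I_N.+1) : {mpoly K[R + C + N.+1]} := 'X_(rshift (R + C) k).

(* The variable of index [k] in [{mpoly K[#|{: 'I_R * 'I_C}|]}] is x_c for the
   cell [c = enum_val k]. *)
Definition generators S : #|{: 'I_R * 'I_C}|.-tuple {mpoly K[R + C + N.+1]} :=
  [tuple let c := enum_val k in var_u c.1 * var_v c.2 * var_w (layer S c) | k < _].

Definition toric_map S (p : {mpoly K[#|{: 'I_R * 'I_C}|]}) :
    {mpoly K[R + C + N.+1]} :=
  p \mPo generators S.

Definition toric_ideal S (p : {mpoly K[#|{: 'I_R * 'I_C}|]}) : Prop :=
  toric_map S p = 0.

Definition semigroup_ring S : idomainType := subalgebra (generators S).

Definition semigroup_ring_deg S (d : nat) (a : semigroup_ring S) : Prop :=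
  exists2 q : {mpoly K[#|{: 'I_R * 'I_C}|]},
    q \is d.-homog & val a = toric_map S q.

End NestedRectangles.

(* Main.v *)
(* The levels rho(i), gamma(j) count the rectangles missing row i, column j, so
   that the cell (i,j) lies in the layer max(rho(i), gamma(j)) and has
   multidegree u_i v_j w_max(rho(i), gamma(j)).  Rank the rows and the columns by
   level.  Call a pair of cells (i,j), (i',j') with i < i' and j < j' forbidden
   when exchanging columns preserves the multiset of layers, that is, when
   min(rho(i'), gamma(j')) <= max(rho(i), gamma(j)).  Giving x_ij the weight
   rank(i) * rank(j) makes the forbidden pairs leading terms of quadratic
   binomials of the ideal.  A monomial without forbidden pairs is determined by
   its multidegree: the cells of the first occurring layer l pair the largest rows
   of level at most l with the largest columns of level at most l, in opposite
   order.  So the forbidden pairs generate the initial ideal, which gives (i) and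
   (ii).

   For (iii), the multidegrees of the monomials are the lattice points of a cone,
   and a fraction f/g that is almost integral has lm(f) - lm(g) in this cone, so
   that f can be divided by g term by term.

   For (iv), start from the row of variables and iterate Schreyer's construction
   over the semigroup ring: if the leading terms of a Groebner basis of a
   submodule of a free module are x_t e_k, then those of its syzygies are again
   linear because the initial ideal is quadratic. *)
Require Import Defs.
From HB Require Import structures.
From mathcomp Require Import all_boot all_order all_algebra zify.
From mathcomp.classical Require Import boolp.
From mathcomp.multinomials Require Import ssrcomplements mpoly.

Set Implicit Arguments.
Unset Strict Implicit.
Unset Printing Implicit Defensive.

Import Order.TTheory GRing.Theory.
Local Open Scope ring_scope.

(** * Linear maps induced by maps of exponents *)

Section Relabel.
Context (K : fieldType) (n1 n2 : nat) (e : 'X_{1..n1} -> 'X_{1..n2}).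

(** One construction serves for the toric map, with [e] the multidegree, and for reduction, with [e]
    the normal form of a monomial. *)
Definition relabel (p : {mpoly K[n1]}) : {mpoly K[n2]} :=
  \sum_(m <- msupp p) p@_m *: 'X_[e m].

(** A common degree bound gives sums over a fixed index set, so that linearity can be checked term
    by term. *)
Lemma relabelwE d p : (msize p <= d)%N ->
  relabel p = \sum_(m : 'X_{1..n1 < d}) p@_m *: 'X_[e m].
Proof.
move=> le_pd; rewrite /relabel (big_mksub 'X_{1..n1 < d}) ?msupp_uniq //=; last first.
  by move=> x /msize_mdeg_lt /leq_trans; apply.
by rewrite big_rmcond //= => m /memN_msupp_eq0 ->; rewrite scale0r.
Qed.

Lemma relabel_is_linear : linear relabel.
Proof.
move=> c p q; pose d := maxn (msize (c *: p + q)) (maxn (msize p) (msize q)).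
rewrite !(@relabelwE d) ?leq_max ?leqnn ?orbT // scaler_sumr -big_split /=.
by apply: eq_bigr => m _; rewrite mcoeffD mcoeffZ scalerDl scalerA.
Qed.

HB.instance Definition _ :=
  GRing.isLinear.Build K {mpoly K[n1]} {mpoly K[n2]} _ relabel relabel_is_linear.

Lemma relabelX m : relabel 'X_[m] = 'X_[e m].
Proof. by rewrite /relabel msuppX big_seq1 mcoeffX eqxx scale1r. Qed.

Lemma mcoeff_relabel p m :
  (relabel p)@_m = \sum_(m' <- msupp p | e m' == m) p@_m'.
Proof.
rewrite raddf_sum /= [RHS]big_mkcond /=; apply: eq_bigr => m' _.
by rewrite mcoeffZ mcoeffX; case: eqP => _; rewrite ?mulr1 ?mulr0.
Qed.

Lemma msupp_relabel p m :
  m \in msupp (relabel p) -> exists2 m', m' \in msupp p & m = e m'.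
Proof.
rewrite mcoeff_msupp mcoeff_relabel => nz.
have [/hasP[m' m'p /eqP <-]|/hasPn none] := boolP (has (fun m' => e m' == m) (msupp p)).
  by exists m'.
by case/eqP: nz; rewrite big_seq_cond big1 // => m' /andP[/none/negPf->].
Qed.

End Relabel.

(** Each coefficient of the image is a sum over one fiber of the exponent map, so the kernel depends
    only on the partition into fibers. *)
Lemma relabel_ker (K : fieldType) n1 n2 n3 (e : 'X_{1..n1} -> 'X_{1..n2})
    (f : 'X_{1..n1} -> 'X_{1..n3}) (p : {mpoly K[n1]}) :
  (forall m m', f m = f m' -> e m = e m') -> (forall m m', e m = e m' -> f m = f m') ->
  relabel e p = 0 -> relabel f p = 0.
Proof.
move=> fe ef p0; apply/mpolyP => M; rewrite mcoeff0 mcoeff_relabel.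
have [/hasP[m mp /eqP <-]|/hasPn none] := boolP (has (fun m => f m == M) (msupp p)).
  transitivity (relabel e p)@_(e m); last by rewrite p0 mcoeff0.
  rewrite mcoeff_relabel; apply: eq_bigl => m'.
  by apply/eqP/eqP; [apply: fe|apply: ef].
by rewrite big_seq_cond big1 // => m' /andP[/none/negPf->].
Qed.

Lemma seq_argmax (T : eqType) d (O : orderType d) (f : T -> O) (s : seq T) :
  s != [::] -> exists2 x, x \in s & forall y, y \in s -> (f y <= f x)%O.
Proof.
elim: s => // a s IH _; have [->|/IH[x xs xmax]] := eqVneq s [::].
  by exists a => [|y]; rewrite !inE // => /eqP->.
have [ax|xa] := leP (f a) (f x).
  by exists x => [|y]; rewrite !inE ?xs ?orbT // => /orP[/eqP->|/xmax].
exists a => [|y]; rewrite !inE ?eqxx // => /orP[/eqP->//|/xmax yx].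
exact: le_trans yx (ltW xa).
Qed.

(** * Quadratic normal forms and initial ideals *)

Section NormalForm.
Context (K : fieldType) (n n' : nat).
(* The monomial order of K[x_1, ..., x_n] is pulled back along the additive
   embedding [enc], so that its well-foundedness is that of the library order. *)
Context (enc : 'X_{1..n} -> 'X_{1..n'}) (nf : 'X_{1..n} -> 'X_{1..n}) (forb : rel 'I_n).
Hypothesis encD : forall m1 m2, enc (m1 + m2)%MM = (enc m1 + enc m2)%MM.
Hypothesis enc_inj : injective enc.
Hypothesis nfK : forall m, nf (nf m) = nf m.
Hypothesis nf_le : forall m, (enc (nf m) <= enc m)%O.
Hypothesis nfD : forall m1 m2, nf (nf m1 + m2)%MM = nf (m1 + m2)%MM.
Hypothesis mdeg_nf : forall m, mdeg (nf m) = mdeg m.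
Hypothesis nf_forb : forall (m : 'X_{1..n}) s t,
  nf m = m -> (0 < m s)%N -> (0 < m t)%N -> ~~ forb s t.
Hypothesis forb_nf : forall m : 'X_{1..n},
  (forall s t, (0 < m s)%N -> (0 < m t)%N -> ~~ forb s t) -> nf m = m.
Hypothesis forb_irr : forall s, ~~ forb s s.

Local Notation S := {mpoly K[n]}.
Local Notation NF := (@relabel K n n nf).

(** By bilinearity this is [nfD] on monomials; it makes the kernel of [NF] an ideal. *)
Lemma NF_mul p q : NF (NF p * q) = NF (p * q).
Proof.
rewrite {2}/relabel [in RHS](mpolyE p) !mulr_suml !linear_sum /=; apply: eq_bigr => m _.
rewrite -!scalerAl !linearZ /=; congr (_ *: _).
rewrite (mpolyE q) !mulr_sumr !linear_sum /=; apply: eq_bigr => m' _.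
by rewrite -!scalerAr !linearZ /= -!mpolyXD !relabelX nfD.
Qed.

Lemma NF_NF p : NF (NF p) = NF p.
Proof. by rewrite -[in LHS](mulr1 (NF p)) NF_mul mulr1. Qed.

Definition nf_le_rel : rel 'X_{1..n} := fun m1 m2 => (enc m1 <= enc m2)%O.

Lemma nf_monomial_order : monomial_order nf_le_rel.
Proof.
have enc0 : enc 0%MM = 0%MM.
  by apply: (@addmI _ (enc 0%MM)); rewrite -encD !addm0.
split.
- by move=> m1 m2; apply: le_total.
- by move=> m1 m2 /le_anti/enc_inj.
- by move=> m1 m2 m3; apply: le_trans.
- by move=> m; rewrite /nf_le_rel enc0 le0m.
- by move=> m m1 m2; rewrite /nf_le_rel !encD lemc_add2l.
Qed.

(** If [m] were its own normal form, any other monomial of [p] reducing to [m] would exceed [m], so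
    the coefficient of [m] would survive in [NF p]. *)
Lemma initial_monomial_nf (p : S) m : NF p = 0 -> initial_monomial nf_le_rel p m -> nf m <> m.
Proof.
move=> p0 [mp mmax] nfm; have /(congr1 (mcoeff m)) := p0.
rewrite mcoeff_relabel mcoeff0 big_mkcond (bigD1_seq m) ?msupp_uniq //=.
rewrite nfm eqxx big_seq_cond big1 ?addr0 => [pm0|m' /andP[/mmax le_m' ne]].
  by move: mp; rewrite mcoeff_msupp pm0 eqxx.
case: eqP => // nfm'; case/eqP: ne; apply/enc_inj/le_anti.
by rewrite -{2}nfm' nf_le andbT.
Qed.

Lemma not_nf_forb (m : 'X_{1..n}) : nf m <> m -> exists k k', forb k k' /\ (U_(k) + U_(k') <= m)%MM.
Proof.
move=> nfm; have [[k [k' [mk mk' f]]]|none] :=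
  pselect (exists k k', [/\ (0 < m k)%N, (0 < m k')%N & forb k k']); last first.
  by case: nfm; apply: forb_nf => k k' mk mk'; apply/negP => f; apply: none; exists k, k'.
(* The two variables are distinct since [forb] is irreflexive, so positive exponents give
   divisibility by their product. *)
exists k, k'; split=> //; apply/mnm_lepP => x; rewrite mnmDE !mnm1E.
case: (eqVneq k x) (eqVneq k' x) => [kx|_] [k'x|_] //; try by subst x.
by move: f; rewrite kx k'x (negPf (forb_irr x)).
Qed.

Lemma forb_not_nf k k' : forb k k' -> nf (U_(k) + U_(k'))%MM <> (U_(k) + U_(k'))%MM.
Proof.
move=> f nfm; have := @nf_forb _ k k' nfm.
by rewrite !mnmDE !mnm1E !eqxx addn1 f => /(_ isT isT).
Qed.

Lemma generated_ideal_mul (F1 F2 : S -> Prop) p :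
  (forall q, F1 q -> exists a b, F2 b /\ q = a * b) ->
  generated_ideal F1 p -> generated_ideal F2 p.
Proof.
move=> F12 [s sF1 ->]; elim: s sF1 => [|x s IH] sF1; first by exists [::]; rewrite ?big_nil.
have [|t tF2 tE] := IH; first by move=> y ys; apply: sF1; rewrite inE ys orbT.
have [|a [b [bF2 bE]]] := F12 x.2; first by apply: sF1; rewrite inE eqxx.
exists ((x.1 * a, b) :: t) => [y|]; first by rewrite inE => /predU1P[->|/tF2].
by rewrite !big_cons tE /= bE mulrA.
Qed.

Section InitialIdeal.
Context (I : S -> Prop) (I_NF : forall p, I p <-> NF p = 0).

Lemma initial_gen (q : S) m : (exists f, [/\ I f, initial_monomial nf_le_rel f m & q = 'X_[m]]) ->
  exists k k', forb k k' /\ q = 'X_[m - (U_(k) + U_(k'))] * 'X_[U_(k) + U_(k')].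
Proof.
case=> f [/I_NF f0 fm ->]; have [k [k' [kk' le_m]]] := not_nf_forb (initial_monomial_nf f0 fm).
by exists k, k'; split=> //; rewrite -mpolyXD submK.
Qed.

Definition forb_binomial k k' : S :=
  'X_[U_(k) + U_(k')] - 'X_[nf (U_(k) + U_(k'))].

Lemma forb_binomialP k k' : forb k k' ->
  [/\ I (forb_binomial k k'), initial_monomial nf_le_rel (forb_binomial k k') (U_(k) + U_(k'))%MM
    & msize (forb_binomial k k') = 3%N].
Proof.
move=> f; have ne := forb_not_nf f; rewrite /forb_binomial; set m := (_ + _)%MM in ne *.
have m_supp : m \in msupp ('X_[m] - 'X_[nf m] : S).
  by rewrite mcoeff_msupp mcoeffB !mcoeffX eqxx (negPf (introN eqP ne)) subr0 oner_eq0.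
split.
- by apply/I_NF; rewrite linearB /= !relabelX nfK subrr.
- split=> // m' /msuppB_le; rewrite mem_cat !msuppX !inE => /orP[]/eqP->; rewrite /nf_le_rel //.
(* The degree is exactly two: [m] occurs in the binomial, and [nf] preserves degrees. *)
- have dm : mdeg m = 2%N by rewrite mdegD !mdeg1.
  have := msize_mdeg_lt m_supp; rewrite dm => gt2; apply/eqP; rewrite eqn_leq gt2 andbT.
  by rewrite (leq_trans (msizeD_le _ _)) // geq_max msizeN !msizeX mdeg_nf dm.
Qed.

Lemma nf_quadratic_groebner : has_quadratic_groebner_basis I.
Proof.
pose G := [seq forb_binomial x.1 x.2 | x <- enum {: 'I_n * 'I_n} & forb x.1 x.2].
have GP g : g \in G -> exists k k', forb k k' /\ g = forb_binomial k k'.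
  by move=> /mapP[[k k']]; rewrite mem_filter => /andP[f _] ->; exists k, k'.
exists nf_le_rel, G; split; first exact: nf_monomial_order; last first.
  by move=> g /GP[k [k' [/forb_binomialP[_ _ +] ->]]].
split=> [g /GP[k [k' [/forb_binomialP[+ _ _] ->]]] //|p]; split; apply: generated_ideal_mul.
  move=> q [f [m [/GP[k [k' [/forb_binomialP[If _ _] fE]]] fm qE]]].
  by exists 1, q; split; rewrite ?mul1r //; exists f, m; rewrite fE in fm *.
move=> q [f [m [If fm qE]]]; have [|k [k' [kk' ->]]] := @initial_gen q m; first by exists f.
exists 'X_[m - (U_(k) + U_(k'))], 'X_[U_(k) + U_(k')]; split=> //.
have [_ init _] := forb_binomialP kk'.
exists (forb_binomial k k'), (U_(k) + U_(k'))%MM; split=> //.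
by apply/mapP; exists (k, k'); rewrite // mem_filter kk' mem_enum.
Qed.

Lemma nf_squarefree_initial : has_squarefree_initial_ideal I.
Proof.
exists nf_le_rel, (fun m => exists k k', forb k k' /\ m = (U_(k) + U_(k'))%MM).
split; first exact: nf_monomial_order.
  move=> m [k [k' [f ->]]] i; rewrite mnmDE !mnm1E.
  case: (eqVneq k i) (eqVneq k' i) => [ki|_] [k'i|_] //.
  by move: f; rewrite ki k'i (negPf (forb_irr i)).
move=> p; split; apply: generated_ideal_mul => q.
  move=> [f [m [If fm qE]]]; have [|k [k' [kk' ->]]] := @initial_gen q m; first by exists f.
  exists 'X_[m - (U_(k) + U_(k'))], 'X_[U_(k) + U_(k')]; split=> //.
  by exists (U_(k) + U_(k'))%MM => //; exists k, k'.
move=> [m [k [k' [/forb_binomialP[If init _] ->]]] ->]; exists 1, 'X_[U_(k) + U_(k')].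
by split; rewrite ?mul1r //; exists (forb_binomial k k'), (U_(k) + U_(k'))%MM.
Qed.

End InitialIdeal.

(** * The linear resolution *)

(* The free modules over the quotient by the toric ideal are represented by row
   vectors over the polynomial ring; [null] vectors represent zero. *)
Definition null b (V : 'rV[S]_b) := forall k, NF (V 0 k) = 0.

Lemma nullD b (V W : 'rV[S]_b) : null V -> null W -> null (V + W).
Proof. by move=> V0 W0 k; rewrite mxE linearD /= V0 W0 addr0. Qed.

Lemma nullN b (V : 'rV[S]_b) : null V -> null (- V).
Proof. by move=> V0 k; rewrite mxE linearN /= V0 oppr0. Qed.

Lemma nullZ b (X : S) (V : 'rV[S]_b) : null V -> null (X *: V).
Proof. by move=> V0 k; rewrite mxE mulrC -NF_mul V0 mul0r linear0. Qed.

Lemma nullM b b' (V : 'rV[S]_b) (D : 'M[S]_(b, b')) : null V -> null (V *m D).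
Proof.
move=> V0 k; rewrite mxE linear_sum /= big1 // => j _.
by rewrite -NF_mul V0 mul0r linear0.
Qed.

Definition nfv b (V : 'rV[S]_b) : 'rV[S]_b := map_mx NF V.

Lemma null_nfv b (V : 'rV[S]_b) : null (nfv V - V).
Proof. by move=> k; rewrite !mxE linearB /= NF_NF subrr. Qed.

Local Notation keyT := ('X_{1..n'} *l nat)%type.
(* The Schreyer order on the terms [x^m e_k] of a free module whose basis element
   [e_k] has multidegree [s k]. *)
Definition key b (s : 'I_b -> 'X_{1..n}) (k : 'I_b) (m : 'X_{1..n}) : keyT :=
  (enc (m + s k)%MM, k : nat).

(** Lexicographic induction on the monomial order and on the index; it makes division terminate. *)
Lemma key_wf : well_founded (fun x y : keyT => (x < y)%O).
Proof.
case=> a; elim/(@ltmwf n'): a => a IHa k; elim/ltn_ind: k => k IHk.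
apply: Acc_intro => -[a' k']; rewrite ltxi_pair le_eqVlt.
have [->|_] := eqVneq a' a; first by rewrite lexx => /IHk.
by case/andP=> lt_a _; apply: IHa lt_a _.
Qed.

Lemma key_inj b (s : 'I_b -> 'X_{1..n}) k k' m m' :
  key s k m = key s k' m' -> k = k' /\ m = m'.
Proof. by move=> [/enc_inj E /val_inj ?]; subst k'; split=> //; apply: addIm E. Qed.

Lemma key_nf b (s : 'I_b -> 'X_{1..n}) k m : (key s k (nf m) <= key s k m)%O.
Proof. by rewrite lexi_pair lexx implybT andbT !encD lemc_add2l. Qed.

Lemma key_add b (s : 'I_b -> 'X_{1..n}) k k' u m m' :
  (key s k (u + m) <= key s k' (u + m'))%O = (key s k m <= key s k' m')%O.
Proof. by rewrite !lexi_pair -!addmA !(encD u) !lemc_add2r. Qed.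

Definition below b (s : 'I_b -> 'X_{1..n}) (B : keyT) (V : 'rV[S]_b) :=
  forall k m, m \in msupp (V 0 k) -> (key s k m < B)%O.

Definition atmost b (s : 'I_b -> 'X_{1..n}) (B : keyT) (V : 'rV[S]_b) :=
  forall k m, m \in msupp (V 0 k) -> (key s k m <= B)%O.

Lemma atmost_nfv b (s : 'I_b -> 'X_{1..n}) B V : atmost s B V -> atmost s B (nfv V).
Proof.
move=> VB k m; rewrite mxE => /msupp_relabel[m' /VB le_m' ->].
exact: le_trans (key_nf _ _ _) le_m'.
Qed.

Lemma below_nfv b (s : 'I_b -> 'X_{1..n}) B V : below s B V -> below s B (nfv V).
Proof.
move=> VB k m; rewrite mxE => /msupp_relabel[m' /VB le_m' ->].
exact: le_lt_trans (key_nf _ _ _) le_m'.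
Qed.

(** [key] is injective, so only the term with vanishing coefficient could attain the bound. *)
Lemma atmost_below b (s : 'I_b -> 'X_{1..n}) k m V :
  atmost s (key s k m) V -> (V 0 k)@_m = 0 -> below s (key s k m) V.
Proof.
move=> VB V0 k' m' m'V; rewrite lt_neqAle VB // andbT.
apply/eqP => /key_inj[? ?]; subst k' m'.
by move: m'V; rewrite mcoeff_msupp V0 eqxx.
Qed.

Lemma atmostB b (s : 'I_b -> 'X_{1..n}) B V W :
  atmost s B V -> atmost s B W -> atmost s B (V - W).
Proof.
by move=> VB WB k m; rewrite !mxE => /msuppB_le; rewrite mem_cat => /orP[/VB|/WB].
Qed.

Lemma nfv_nfv b (V : 'rV[S]_b) : nfv (nfv V) = nfv V.
Proof. by apply/rowP => k; rewrite !mxE NF_NF. Qed.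

Lemma nfv_std b (V : 'rV[S]_b) k m : nfv V = V -> m \in msupp (V 0 k) -> nf m = m.
Proof. by move=> <-; rewrite mxE => /msupp_relabel[m' _ ->]. Qed.

Lemma rowBE b (V W : 'rV[S]_b) k : (V - W) 0 k = V 0 k - W 0 k.
Proof. by rewrite !mxE. Qed.

Lemma leading_term b (s : 'I_b -> 'X_{1..n}) (V : 'rV[S]_b) : V != 0 ->
  exists k m, m \in msupp (V 0 k) /\ atmost s (key s k m) V.
Proof.
move=> /eqP V0.
pose L := [seq (k, m) | k <- enum 'I_b, m <- msupp (V 0 k)].
have memL k m : ((k, m) \in L) = (m \in msupp (V 0 k)).
  by apply/allpairsPdep/idP => [[k' [m' [_ ? [-> ->]]]] //|?]; exists k, m; rewrite mem_enum.
have /(seq_argmax (fun x => key s x.1 x.2))[[k m]] : L != [::].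
  apply/eqP => L0; apply: V0; apply/rowP => k; rewrite mxE.
  apply: msuppnil0; apply/eqP; case E: (msupp _) => [//|m l].
  by have := memL k m; rewrite L0 E inE eqxx.
by rewrite memL => mV max; exists k, m; split=> // k' m'; rewrite -memL => /max.
Qed.

Lemma msupp_scaleXM (c : K) (u m : 'X_{1..n}) (p : S) :
  m \in msupp ((c *: 'X_[u]) * p) -> exists2 m', m' \in msupp p & m = (u + m')%MM.
Proof.
move=> /msuppM_le/allpairsP[[m1 m2] /= [/msuppZ_le]].
by rewrite msuppX inE => /eqP-> m2p ->; exists m2.
Qed.

(* The row [r] of [D] has leading term [x_(tau r) e_(kap r)], and by [stage_gb] the
   rows form a Groebner basis of the submodule that they generate. *)
Record stage b (s : 'I_b -> 'X_{1..n}) b' (D : 'M[S]_(b', b))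
    (kap : 'I_b' -> 'I_b) (tau : 'I_b' -> 'I_n) : Prop := Stage {
  stage_homog : forall r c, D r c \is 1.-homog;
  stage_mono : forall r r' : 'I_b', (r <= r')%N -> (kap r <= kap r')%N;
  stage_inj : forall r r', kap r = kap r' -> tau r = tau r' -> r = r';
  stage_lc : forall r, (D r (kap r))@_U_(tau r) = 1;
  stage_lead : forall r c m, m \in msupp (D r c) ->
    (key s c m <= key s (kap r) U_(tau r))%O;
  stage_gb : forall (V : 'rV_b) (W : 'rV_b') k m,
    nfv V = V -> null (V - W *m D) -> m \in msupp (V 0 k) -> atmost s (key s k m) V ->
    exists2 r, kap r = k & (0 < m (tau r))%N }.

(** * Division in a submodule by a Groebner basis *)

Section Division.
Context b (s : 'I_b -> 'X_{1..n}) b' (D : 'M[S]_(b', b)).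
Context (kap : 'I_b' -> 'I_b) (tau : 'I_b' -> 'I_n) (M : 'rV[S]_b -> Prop).
Hypothesis D_homog : forall r c, D r c \is 1.-homog.
Hypothesis D_lc : forall r, (D r (kap r))@_U_(tau r) = 1.
Hypothesis D_lead : forall r c m, m \in msupp (D r c) ->
  (key s c m <= key s (kap r) U_(tau r))%O.
Hypothesis M_nfv : forall V, M V -> M (nfv V).
Hypothesis M_sub : forall V X r, M V -> M (V - X *: row r D).
Hypothesis M_lead : forall V k m, nfv V = V -> M V -> m \in msupp (V 0 k) ->
  atmost s (key s k m) V -> exists2 r, kap r = k & (0 < m (tau r))%N.

(* The predicate [P] restricts the degrees of the terms, so that dividing a
   homogeneous vector yields homogeneous quotients. *)
Lemma division (P : pred nat) B (V : 'rV[S]_b) :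
  M V -> below s B V ->
  (forall k m, m \in msupp (V 0 k) -> P (mdeg m)) ->
  exists F : 'rV_b', [/\ null (V - F *m D),
    forall r m, m \in msupp (F 0 r) -> (key s (kap r) (U_(tau r) + m) < B)%O
  & forall r m, m \in msupp (F 0 r) -> P (mdeg m).+1].
Proof.
elim/(well_founded_ind key_wf): B V => B IH V MV VB VP.
have [V0|/(leading_term s)[k [m [mV mB]]]] := eqVneq (nfv V) 0.
  exists 0; split=> [|r m|r m]; rewrite ?mxE ?msupp0 //.
  by move=> k; rewrite mul0mx subr0; have /rowP/(_ k) := V0; rewrite !mxE.
have [r kr mr] := M_lead (nfv_nfv V) (M_nfv MV) mV mB; subst k.
set B' := key s (kap r) m in mB *.
have lt_B' : (B' < B)%O by apply: below_nfv VB _ _ mV.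
(* The multiple [X] of the row [r] cancels the leading term of [nfv V]. *)
pose u := (m - U_(tau r))%MM; pose c := (nfv V 0 (kap r))@_m.
have mE : m = (u + U_(tau r))%MM by rewrite submK // lep1mP -lt0n.
pose X : S := c *: 'X_[u]; pose V' := nfv V - X *: row r D.
have rowB : atmost s B' (X *: row r D).
  move=> k' m'; rewrite !mxE => /msupp_scaleXM[m'' /D_lead le_m'' ->].
  by rewrite /B' mE key_add.
have V'B : below s B' V'.
  apply: atmost_below; first exact: atmostB.
  have cX : (X * D r (kap r))@_m = c.
    by rewrite -scalerAl mcoeffZ ['X_[u] * _]mulrC mE mcoeffMX D_lc mulr1.
  by rewrite 3!mxE mcoeffB !mxE cX /c mxE subrr.
have [||F' [F'1 F'2 F'3]] := IH B' lt_B' V' _ V'B.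
- exact/M_sub/M_nfv.
- move=> k' m'; rewrite !mxE => /msuppB_le; rewrite mem_cat => /orP[|].
    by move=> /msupp_relabel[m'' /VP ? ->]; rewrite mdeg_nf.
  (* The rows have linear entries, so the subtracted terms have the degree of [m], a degree already
     met in [V]. *)
  move=> /msupp_scaleXM[m'' /(dhomog_mf (D_homog _ _)) /= dm'' ->].
  move: mV; rewrite mxE mE => /msupp_relabel[m0 /VP]; rewrite -mdeg_nf => + E.
  by rewrite -E !mdegD dm'' mdeg1.
have FE k' m' : m' \in msupp ((F' + X *: delta_mx 0 r) 0 k') ->
    m' \in msupp (F' 0 k') \/ k' = r /\ m' = u.
  rewrite !mxE => /msuppD_le; rewrite mem_cat => /orP[|]; first by left.
  case: (eqVneq k' r) => [->|_]; rewrite ?mulr0 ?msupp0 // ?mulr1.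
  by move=> /msuppZ_le; rewrite msuppX inE => /eqP ->; right.
exists (F' + X *: delta_mx 0 r); split.
- rewrite mulmxDl -scalemxAl -rowE.
  rewrite (_ : _ - _ = (V' - F' *m D) - (nfv V - V)); last first.
    rewrite /V' opprB opprD [RHS]addrC [RHS]addrA subrKA.
    by rewrite addrA addrAC.
  by apply: nullD => //; apply/nullN/null_nfv.
- move=> k' m' /FE[/F'2 /lt_trans ->//|[-> ->]].
  by rewrite addmC -mE.
- move=> k' m' /FE[/F'3//|[_ ->]].
  move: mV; rewrite mxE => /msupp_relabel[m0 /VP]; rewrite -mdeg_nf => + E.
  by rewrite -E mE mdegD mdeg1 addn1.
Qed.

End Division.

(** * Schreyer's construction of the next syzygy matrix *)

Section NextStage.
Context b (s : 'I_b -> 'X_{1..n}) b' (D : 'M[S]_(b', b)).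
Context (kap : 'I_b' -> 'I_b) (tau : 'I_b' -> 'I_n) (st : stage s D kap tau).

(** The multidegree of the leading term of the row [r], as in Schreyer's order on syzygies. *)
Definition next_shift (r : 'I_b') := (s (kap r) + U_(tau r))%MM.

(* [x_t e_r] is the leading term of a syzygy when x_t x_(tau r) can be rewritten, or
   when it comes from an S-pair with an earlier row of the same component. *)
Definition next_lead (r : 'I_b') (t : 'I_n) :=
  [|| forb t (tau r), forb (tau r) t
    | [exists r' : 'I_b', [&& (r' < r)%N, kap r' == kap r & tau r' == t]]].

(** Both keys have the same first component; ties are broken by [kap] on one side and by the row
    index on the other, and [kap] is monotone. *)
Lemma key_next r r' m m' :
  (key s (kap r') (U_(tau r') + m') < key s (kap r) (U_(tau r) + m))%O ->
  (key next_shift r' m' < key next_shift r m)%O.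
Proof.
have shiftE q x : (U_(tau q) + x + s (kap q) = x + next_shift q)%MM.
  by rewrite /next_shift [LHS]addmC [RHS]addmC addmA.
rewrite !ltxi_pair !shiftE !ltEnat => /andP[-> /implyP lt_kap]; apply/implyP => /lt_kap.
by apply: contraLR; rewrite -!leqNgt; apply: (stage_mono st).
Qed.

Lemma null_mull c c' (W : 'rV[S]_c) (X : 'M[S]_(c, c')) :
  (forall i, null (row i X)) -> null (W *m X).
Proof.
move=> X0 k; rewrite mxE linear_sum /= big1 // => i _.
by rewrite mulrC -NF_mul; have := X0 i k; rewrite mxE => ->; rewrite mul0r linear0.
Qed.

Lemma mcoeff_NFM p q m : (NF (p * q))@_m =
  \sum_(x <- [seq (m1, m2) | m1 <- msupp p, m2 <- msupp q] | nf (x.1 + x.2)%MM == m)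
     p@_x.1 * q@_x.2.
Proof.
rewrite mpolyME (linear_sum NF) /= raddf_sum /= [RHS]big_mkcond /=; apply: eq_bigr => x _.
by rewrite linearZ /= mcoeffZ relabelX mcoeffX; case: eqP; rewrite ?mulr1 ?mulr0.
Qed.

(** Otherwise x^m x_(tau r) would be a standard monomial that no other term of [V *m D] can
    cancel. *)
Lemma syzygy_lead (V : 'rV_b') r m : nfv V = V -> null (V *m D) ->
  m \in msupp (V 0 r) -> atmost next_shift (key next_shift r m) V ->
  exists2 t, next_lead r t & (0 < m t)%N.
Proof.
move=> nfV VD0 mV mB; have [//|none] := pselect (exists2 t, next_lead r t & (0 < m t)%N).
have m0 t : next_lead r t -> m t = 0%N.
  by move=> rt; apply/eqP; rewrite -leqn0 leqNgt; apply/negP => mt; apply: none; exists t.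
pose M0 := (m + U_(tau r))%MM.
have nfM0 : nf M0 = M0.
  have M0P t : (0 < M0 t)%N -> (0 < m t)%N \/ t = tau r.
    rewrite mnmDE mnm1E; case: eqP => [->|_]; first by right.
    by rewrite addn0; left.
  apply: forb_nf => t1 t2 /M0P[m1|->] /M0P[m2|->] //.
  - exact: nf_forb (nfv_std nfV mV) m1 m2.
  - by apply/negP => f12; move: m1; rewrite m0 // /next_lead f12.
  - by apply/negP => f12; move: m2; rewrite m0 // /next_lead f12 orbT.
(* Only the term x^m e_r of V contributes to the coefficient of the standard
   monomial M0 in the component kap r of V *m D. *)
have uniq_term r' m' u : m' \in msupp (V 0 r') -> u \in msupp (D r' (kap r)) ->
    nf (m' + u)%MM = M0 -> [/\ r' = r, m' = m & u = U_(tau r)%MM].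
  move=> /mB K1 /(stage_lead st) K2 E.
  (* [e1], [e2] and [e3] close a cycle of inequalities, so all are equalities, and the tie-breakers
     of the keys decide: [r' <= r] and [kap r <= kap r']. *)
  have e1 : (enc (M0 + s (kap r)) <= enc (m' + u + s (kap r)))%O.
    by rewrite -E (encD (nf _)) (encD (m' + u)%MM) lemc_add2l.
  move: K2; rewrite lexi_pair => /andP[e2 /implyP K2].
  have {}e2 : (enc (m' + u + s (kap r)) <= enc (m' + (U_(tau r') + s (kap r'))))%O.
    by rewrite -addmA !(encD m') lemc_add2r.
  move: K1; rewrite lexi_pair => /andP[e3 /implyP K1].
  have M0E : (m + next_shift r = M0 + s (kap r))%MM.
    by rewrite /M0 /next_shift -addmA [(U_(_) + _)%MM]addmC.
  have m'E : (m' + next_shift r' = m' + (U_(tau r') + s (kap r')))%MM.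
    by rewrite /next_shift [(U_(_) + _)%MM]addmC.
  rewrite M0E m'E in e3 K1.
  have r'r : (r' <= r)%N by apply: K1; apply: le_trans e1 e2.
  have kk' : (kap r <= kap r')%N.
    apply: K2; have := le_trans e3 e1; rewrite -addmA !(encD m') lemc_add2r.
    by [].
  have kE : kap r = kap r'.
    by apply/val_inj/eqP; rewrite eqn_leq kk' (stage_mono st).
  have /enc_inj : enc (m' + u + s (kap r)) = enc (m' + (U_(tau r') + s (kap r'))).
    by apply/eqP; rewrite eq_le e2 (le_trans e3 e1).
  rewrite -kE addmA => /addIm/addmI uE; subst u.
  have /enc_inj : enc (M0 + s (kap r)) = enc (m' + (U_(tau r') + s (kap r'))).
    by apply/eqP; rewrite eq_le e3 (le_trans e1 e2).
  rewrite -kE addmA => /addIm M0E'.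
  have [r'E|ne] := eqVneq r' r.
    by subst r'; split=> //; move: M0E'; rewrite /M0 => /addIm.
  (* For an earlier row, [next_lead r (tau r')] holds, so x_(tau r') does not divide x^m; it divides
     [M0], hence is x_(tau r), against [stage_inj]. *)
  have lt_r : (r' < r)%N by rewrite ltn_neqAle r'r andbT.
  have := congr1 (fun x : 'X_{1..n} => x (tau r')) M0E'.
  rewrite !mnmDE mnm1E mnm1E eqxx m0; last first.
    by apply/or3P/Or33/existsP; exists r'; rewrite lt_r kE !eqxx.
  case: eqP => [/esym/(stage_inj st)|_]; last by rewrite addn1.
  by move=> /(_ (esym kE)) E'; rewrite E' eqxx in ne.
have /(congr1 (mcoeff M0)) := VD0 (kap r).
rewrite mcoeff0 mxE (linear_sum NF) /= raddf_sum /= (bigD1 r) //=.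
rewrite [X in _ + X]big1 ?addr0; last first.
  move=> r' ne; rewrite mcoeff_NFM big_seq_cond big1 // => -[m' u] /= /andP[/allpairsP].
  case=> -[m1 u1] /= [m1V u1D [-> ->]] /eqP /(uniq_term _ _ _ m1V u1D)[E _ _].
  by rewrite E eqxx in ne.
have UD : U_(tau r)%MM \in msupp (D r (kap r)).
  by rewrite mcoeff_msupp (stage_lc st) oner_neq0.
rewrite mcoeff_NFM big_mkcond (bigD1_seq (m, U_(tau r)%MM)) /=; first last.
- by apply: allpairs_uniq; rewrite ?msupp_uniq // => -[? ?] [? ?].
- by apply/allpairsP; exists (m, U_(tau r)%MM).
rewrite nfM0 eqxx (stage_lc st) mulr1 big_seq_cond big1 ?addr0 => [V0|[m' u] /=].
  by move: mV; rewrite mcoeff_msupp V0 eqxx.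
case/andP=> /allpairsP[[m1 u1] /= [m1V u1D [-> ->]]] ne; case: eqP => // E.
by have [_ E1 E2] := uniq_term _ _ _ m1V u1D E; rewrite E1 E2 eqxx in ne.
Qed.

(** The case of [division] for the span of the rows of [D] up to [null] vectors. *)
Lemma stage_division (P : pred nat) B (V : 'rV[S]_b) W :
  null (V - W *m D) -> below s B V -> (forall k m, m \in msupp (V 0 k) -> P (mdeg m)) ->
  exists F : 'rV_b', [/\ null (V - F *m D),
    forall r m, m \in msupp (F 0 r) -> (key s (kap r) (U_(tau r) + m) < B)%O
  & forall r m, m \in msupp (F 0 r) -> P (mdeg m).+1].
Proof.
move=> V0; apply: (division (M := fun V => exists W, null (V - W *m D))).
- exact: (stage_homog st).
- exact: (stage_lc st).
- exact: (stage_lead st).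
- move=> V1 [W1 VW1]; exists W1; rewrite -(subrKA V1); apply: nullD => //.
  exact: null_nfv.
- move=> V1 X r [W1 VW1]; exists (W1 - X *: delta_mx 0 r).
  by rewrite mulmxBl -scalemxAl -rowE opprB addrA subrK.
- by move=> V1 k m V1nf [W1 VW1]; apply: stage_gb VW1.
- by exists W.
Qed.

(** The image of x_t e_r, corrected by x_(tau r) e_r' for an S-pair, has a normal form below [B];
    dividing it by the rows yields the remaining terms of the syzygy. *)
Lemma next_row r t : next_lead r t -> exists W : 'rV[S]_b',
  [/\ forall c, W 0 c \is 1.-homog, null (W *m D), (W 0 r)@_U_(t) = 1
    & atmost next_shift (key next_shift r U_(t)) W].
Proof.
move=> rt; set B := key s (kap r) (U_(tau r) + U_(t)).
have lead_row q u : kap q = kap r -> (U_(tau q) + u = U_(tau r) + U_(t))%MM ->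
    atmost s B ('X_[u] *: row q D) /\
    (('X_[u] *: row q D) 0 (kap r))@_(U_(tau r) + U_(t)) = 1.
  move=> kq uE; split=> [k m|]; last first.
    by rewrite !mxE mulrC -uE addmC mcoeffMX -kq (stage_lc st).
  rewrite !mxE -['X_[u]]scale1r => /msupp_scaleXM[m' /(stage_lead st) le_m' ->].
  by rewrite /B -uE -kq [(U_(_) + u)%MM]addmC key_add.
have [rowB row1] := lead_row r U_(t)%MM erefl erefl.
have [G [GB GE]] : exists G : 'rV[S]_b',
    below s B (nfv ('X_[U_(t)] *: row r D - G *m D)) /\
    forall c m, m \in msupp (G 0 c) ->
      (key next_shift c m < key next_shift r U_(t))%O /\ mdeg m = 1%N.
  have [/existsP[r' /and3P[lt_r' /eqP kE /eqP tE]]|none] :=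
    boolP [exists r' : 'I_b', [&& (r' < r)%N, kap r' == kap r & tau r' == t]].
    exists ('X_[U_(tau r)] *: delta_mx 0 r'); split=> [|c m]; last first.
      rewrite !mxE; case: (eqVneq c r') => [->|_]; rewrite ?mulr0 ?msupp0 // mulr1.
      rewrite msuppX inE => /eqP ->; rewrite mdeg1; split=> //.
      have -> : key next_shift r' U_(tau r) = (enc (U_(t) + next_shift r)%MM, r' : nat).
        rewrite /key /next_shift kE tE [in LHS]addmC [in RHS]addmC -!addmA.
        by congr (enc (_ + _)%MM, _); apply: addmC.
      by rewrite ltxi_pair lexx /= ltEnat.
    have [|rowB' row1'] := lead_row r' U_(tau r)%MM kE; first by rewrite tE addmC.
    rewrite -scalemxAl -rowE.
    apply/below_nfv/atmost_below; first exact: atmostB rowB rowB'.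
    by rewrite rowBE mcoeffB row1 row1' subrr.
  exists 0; split=> [|c m]; last by rewrite mxE msupp0.
  rewrite mul0mx subr0; apply: atmost_below; first exact: atmost_nfv.
  apply: memN_msupp_eq0; apply/negP => M0.
  have := nf_forb (nfv_std (nfv_nfv _) M0).
  move=> nforb; move: rt; rewrite /next_lead (negPf none) orbF.
  by rewrite !(negPf (nforb _ _ _ _)) // mnmDE !mnm1E eqxx ?addn1.
pose W0 := 'X_[U_(t)] *: delta_mx 0 r - G.
have W0D : W0 *m D = 'X_[U_(t)] *: row r D - G *m D by rewrite mulmxBl -scalemxAl -rowE.
(* The dividend is homogeneous of degree 2, so the quotients are linear. *)
have [||F [F0 FB Fdeg]] := stage_division (P := pred1 2) (W := W0) _ GB.
- by rewrite W0D; apply: null_nfv.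
- move=> k m; rewrite mxE => /msupp_relabel[m' + ->]; rewrite mdeg_nf.
  suff /dhomog_mf h : ('X_[U_(t)] *: row r D - G *m D) 0 k \is 2.-homog by move=> /h /= ->.
  have G1 j : G 0 j \is 1.-homog by apply/dhomogP => m0 /GE[].
  have mul2 (p q : S) : p \is 1.-homog -> q \is 1.-homog -> p * q \is 2.-homog.
    exact: dhomogM.
  rewrite rowBE rpredB // mxE; last first.
    by apply: rpred_sum => j _; apply: mul2 => //; apply: (stage_homog st).
  by rewrite mxE; apply: mul2; [rewrite dhomogX /= mdeg1|apply: (stage_homog st)].
have FB' c m : m \in msupp (F 0 c) -> (key next_shift c m < key next_shift r U_(t))%O.
  by move/FB/key_next.
have W0E c m : m \in msupp (W0 0 c) -> c = r /\ m = U_(t)%MM \/ m \in msupp (G 0 c).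
  rewrite rowBE !mxE => /msuppB_le; rewrite mem_cat => /orP[|]; last by right.
  case: (eqVneq c r) => [->|_]; rewrite ?mulr0 ?msupp0 // mulr1 msuppX inE => /eqP ->.
  by left.
have WE c m : m \in msupp ((W0 - F) 0 c) ->
  (c = r /\ m = U_(t)%MM) \/ (key next_shift c m < key next_shift r U_(t))%O /\ mdeg m = 1%N.
  rewrite rowBE => /msuppB_le; rewrite mem_cat => /orP[/W0E[|/GE]|mF]; [by left|by right|right].
  by split; [apply: FB'|apply/succn_inj/eqP; apply: Fdeg mF].
exists (W0 - F); split.
- move=> c; apply/dhomogP => m /WE[[_ ->]|[_ //]]; exact: mdeg1.
- rewrite mulmxBl -(subrKA (nfv (W0 *m D))); apply: nullD; last by rewrite {1}W0D.
  by rewrite -opprB; apply/nullN/null_nfv.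
- rewrite !rowBE !mxE !eqxx /= mulr1 !mcoeffB mcoeffX eqxx.
  have -> : (G 0 r)@_U_(t) = 0.
    by apply: memN_msupp_eq0; apply/negP => /GE[]; rewrite ltxx.
  have -> : (F 0 r)@_U_(t) = 0.
    by apply: memN_msupp_eq0; apply/negP => /FB'; rewrite ltxx.
  by rewrite !subr0.
- by move=> c m /WE[[-> ->]|[/ltW]].
Qed.

(** Sorting by rows makes the new [kap] monotone, as [stage_mono] demands. *)
Definition next_index : seq ('I_b' * 'I_n) :=
  sort (fun x y : 'I_b' * 'I_n => (x.1 <= y.1)%N)
    [seq x <- enum {: 'I_b' * 'I_n} | next_lead x.1 x.2].

Lemma next_stage : exists b'' (D' : 'M[S]_(b'', b')) kap' tau',
  stage next_shift D' kap' tau' /\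
  forall V : 'rV_b', null (V *m D) <-> exists W, null (V - W *m D').
Proof.
have leT : total (fun x y : 'I_b' * 'I_n => (x.1 <= y.1)%N) by move=> x y; apply: leq_total.
have le_tr : transitive (fun x y : 'I_b' * 'I_n => (x.1 <= y.1)%N).
  by move=> x y z; apply: leq_trans.
have memJ x : (x \in next_index) = next_lead x.1 x.2.
  by rewrite mem_sort mem_filter mem_enum andbT.
have uniqJ : uniq next_index by rewrite sort_uniq filter_uniq ?enum_uniq.
pose J := in_tuple next_index.
have [W WP] := boolp.choice (fun i => next_row (etrans (esym (memJ _)) (mem_tnth i J))).
pose D' := \matrix_(i, c) W i 0 c.
pose kap' i := (tnth J i).1; pose tau' i := (tnth J i).2.
have D'row i : row i D' = W i by apply/rowP => c; rewrite !mxE.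
have D'D V F : null (V - F *m D') -> null (V *m D).
  move=> VF; have -> : V *m D = (V - F *m D') *m D + F *m (D' *m D).
    by rewrite mulmxBl mulmxA subrK.
  apply: nullD; first exact: nullM.
  by apply: null_mull => i; rewrite row_mul D'row; have [] := WP i.
have D'_homog i c : D' i c \is 1.-homog by rewrite mxE; have [] := WP i.
have D'_lc i : (D' i (kap' i))@_U_(tau' i) = 1 by rewrite mxE; have [] := WP i.
have D'_lead i c m : m \in msupp (D' i c) ->
    (key next_shift c m <= key next_shift (kap' i) U_(tau' i))%O.
  by rewrite mxE; have [_ _ _] := WP i; apply.
have D'_gb (V : 'rV_b') k m : nfv V = V -> null (V *m D) -> m \in msupp (V 0 k) ->
    atmost next_shift (key next_shift k m) V -> exists2 r, kap' r = k & (0 < m (tau' r))%N.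
  move=> Vnf V0 mV mB; have [t kt mt] := syzygy_lead Vnf V0 mV mB.
  have /seq_tnthP[i iE] : (k, t) \in next_index by rewrite memJ.
  by exists i; rewrite /kap' /tau' -iE.
exists (size next_index), D', kap', tau'; split.
  split=> //.
  - move=> i j le_ij; have [x0 _] : exists x0 : 'I_b' * 'I_n, True by exists (tnth J i).
    rewrite /kap' (tnth_nth x0) (tnth_nth x0 J j).
    by apply: (sorted_leq_nth le_tr) => //; rewrite ?inE ?ltn_ord //; apply: sort_sorted.
  - move=> i j k_ij t_ij; apply/val_inj/eqP.
    have [x0 _] : exists x0 : 'I_b' * 'I_n, True by exists (tnth J i).
    have tJ k : tnth J k = nth x0 next_index k by apply: tnth_nth.
    have /= <- := nth_uniq x0 (ltn_ord i) (ltn_ord j) uniqJ.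
    by apply/eqP; rewrite -!tJ; apply: injective_projections.
  - by move=> V F k m Vnf /D'D V0; apply: D'_gb.
move=> V; split=> [V0|[F /D'D //]].
have [->|/(leading_term next_shift)[k [m [mV mB]]]] := eqVneq V 0.
  by exists 0; rewrite mul0mx subr0 => k; rewrite mxE linear0.
have M_nfv (V1 : 'rV_b') : null (V1 *m D) -> null (nfv V1 *m D).
  move=> V10; rewrite -(subrK V1 (nfv V1)) mulmxDl; apply: nullD => //.
  exact/nullM/null_nfv.
have M_sub (V1 : 'rV_b') X r : null (V1 *m D) -> null ((V1 - X *: row r D') *m D).
  move=> V10; rewrite mulmxBl; apply: nullD => //; apply: nullN.
  by rewrite -scalemxAl D'row; apply: nullZ; have [] := WP r.
(* The successor [k.+1] turns the bound by the leading key into a strict one. *)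
have VB : below next_shift ((enc (m + next_shift k)%MM, k.+1) : keyT) V.
  move=> k' m' /mB le_k'; apply: le_lt_trans le_k' _.
  by rewrite ltxi_pair lexx /= ltEnat /=.
have [//|F [F0 _ _]] := division (M := fun V => null (V *m D)) D'_homog D'_lc D'_lead
  M_nfv M_sub D'_gb (P := predT) V0 VB.
by exists F.
Qed.

End NextStage.

(** * The first map of the resolution and its iteration *)

Definition base_matrix : 'M[S]_(n, 1) := \matrix_(r, c) 'X_r.

(** Reduction preserves degrees, so multiples of variables have no constant term; conversely every
    nonconstant monomial is a multiple of a variable. *)
Lemma in_base_image (V : 'rV[S]_1) :
  (exists W, null (V - W *m base_matrix)) <-> (NF (V 0 0))@_0%MM = 0.
Proof.
split=> [[W V0]|V0].
  have E : NF (V 0 0) = NF ((W *m base_matrix) 0 0).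
    by have /eqP := V0 0; rewrite rowBE linearB /= subr_eq0 => /eqP.
  rewrite E; apply: memN_msupp_eq0; apply/negP => /msupp_relabel[m mW /(congr1 mdeg)].
  rewrite mdeg0 mdeg_nf => /esym/eqP; rewrite mdeg_eq0 => /eqP m0; move: mW; rewrite {}m0.
  rewrite mxE => /msupp_sum_le /flatten_mapP[r _]; rewrite mxE => /msuppM_le/allpairsP.
  case=> -[m1 m2] /= [_]; rewrite msuppX inE => /eqP -> /(congr1 mdeg).
  by rewrite mdeg0 mdegD mdeg1 addn1.
have inX m : m != 0%MM -> exists w : 'rV[S]_n, 'X_[m] = \sum_r w 0 r * 'X_r.
  move=> m0; have [r mr] : exists r, m r != 0%N.
    apply/existsP; apply: contraR m0 => /existsPn m0; apply/eqP/mnmP => r.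
    by rewrite mnm0E; apply/eqP; rewrite -[_ == _]negbK m0.
  exists ('X_[m - U_(r)] *: delta_mx 0 r); rewrite (bigD1 r) //= big1 => [|r' ne].
    by rewrite !mxE !eqxx mulr1 addr0 -mpolyXD submK // lep1mP.
  by rewrite !mxE (negPf ne) andbF mulr0 mul0r.
have [w wE] : exists w : 'rV[S]_n, NF (V 0 0) = \sum_r w 0 r * 'X_r.
  rewrite [NF _]mpolyE big_seq; elim/big_ind: _ => [|p q [w ->] [w' ->]|m].
  - by exists 0; rewrite big1 // => r _; rewrite mxE mul0r.
  - by exists (w + w'); rewrite -big_split; apply: eq_bigr => r _; rewrite mxE mulrDl.
  - rewrite mcoeff_msupp => m0; have [|w wE] := inX m.
      by apply: contraNneq m0 => ->; rewrite V0.
    exists (((NF (V 0 0))@_m)%:MP *: w); rewrite wE scaler_sumr; apply: eq_bigr => r _.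
    by rewrite mxE -mulrA mul_mpolyC.
exists w => k; rewrite !ord1 rowBE mxE.
under eq_bigr do rewrite [base_matrix _ _]mxE.
by rewrite -wE linearB /= NF_NF subrr.
Qed.

Lemma base_stage : stage (fun _ : 'I_1 => 0%MM) base_matrix (fun _ => 0) id.
Proof.
split=> // [r c|r|r c m|V W k m nfV VW mV _].
- by rewrite mxE dhomogX /= mdeg1.
- by rewrite mxE mcoeffX eqxx.
- by rewrite mxE msuppX inE => /eqP->; rewrite (ord1 c).
have /in_base_image V0 : exists W, null (V - W *m base_matrix) by exists W.
have NFV : NF (V 0 0) = V 0 0 by rewrite -[in RHS]nfV mxE.
move: mV; rewrite (ord1 k) => mV.
have m0 : m != 0%MM.
  by apply: contraTneq mV => ->; rewrite mcoeff_msupp -NFV V0 eqxx.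
have [r mr] : exists r, (0 < m r)%N.
  apply/existsP; apply: contraR m0 => /existsPn m0; apply/eqP/mnmP => r.
  by rewrite mnm0E; apply/eqP; rewrite -leqn0 leqNgt m0.
by exists r.
Qed.

(** Bundling the ranks, which vary with the stage, makes the construction a self-map that can be
    iterated. *)
Record state := State {
  state_b : nat; state_shift : 'I_state_b -> 'X_{1..n}; state_b' : nat;
  state_D : 'M[S]_(state_b', state_b);
  state_kap : 'I_state_b' -> 'I_state_b; state_tau : 'I_state_b' -> 'I_n;
  stateP : stage state_shift state_D state_kap state_tau }.

Definition base_state := State base_stage.

Record syzygies (x : state) := Syzygies {
  syz_b : nat; syz_D : 'M[S]_(syz_b, state_b' x);
  syz_kap : 'I_syz_b -> 'I_(state_b' x); syz_tau : 'I_syz_b -> 'I_n;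
  syz_stage : stage (next_shift (@state_shift x) (@state_kap x) (@state_tau x))
    syz_D syz_kap syz_tau;
  syz_exact : forall V : 'rV_(state_b' x),
    null (V *m state_D x) <-> exists W, null (V - W *m syz_D) }.

Lemma syzygies_exist : inhabited (forall x, syzygies x).
Proof.
have ex x : exists y : syzygies x, True.
  have [b [D [kap [tau [st exact]]]]] := next_stage (stateP x).
  by exists (Syzygies st exact).
exact: inhabits (fun x => sval (cid (ex x))).
Qed.

Lemma linear_resolution : exists (b : nat -> nat) (d : forall i, 'M[S]_(b i.+1, b i)),
  [/\ b 0%N = 1%N, forall i r c, d i r c \is 1.-homog,
    forall V : 'rV_(b 0%N),
      (exists W, null (V - W *m d 0%N)) <-> (forall j, (NF (V 0 j))@_0%MM = 0)
  & forall i (V : 'rV_(b i.+1)),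
      null (V *m d i) <-> exists W, null (V - W *m d i.+1)].
Proof.
have [syz] := syzygies_exist.
pose next x := State (syz_stage (syz x)); pose x i := iter i next base_state.
exists (fun i => state_b (x i)), (fun i => state_D (x i)); split=> //.
- by move=> i r c; apply: stage_homog (stateP _) _ _.
- move=> V; apply: iff_trans (in_base_image V) _.
  by split=> [V0 j|]; [rewrite (ord1 j)|apply].
- by move=> i V; apply: syz_exact.
Qed.

(** * Descent of the resolution to the quotient ring *)

Context (A : comNzRingType) (phi : {rmorphism S -> A}) (gr : nat -> A -> Prop).
Hypothesis phi_surj : forall a, exists p, a = phi p.
Hypothesis phi_ker : forall p, phi p = 0 <-> NF p = 0.
Hypothesis grE : forall d a, gr d a <-> exists2 q, q \is d.-homog & a = phi q.

Lemma phi_eq p q : phi p = phi q <-> NF p = NF q.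
Proof.
split=> [/eqP|/eqP]; rewrite -subr_eq0 => /eqP pq; apply/eqP; rewrite -subr_eq0; apply/eqP.
  by rewrite -linearB; apply/phi_ker; rewrite rmorphB.
by rewrite -rmorphB; apply/phi_ker; rewrite linearB.
Qed.

Lemma irrelevant_ideal_phi p : irrelevant_ideal gr (phi p) <-> (NF p)@_0%MM = 0.
Proof.
split=> [[k [f [f_gr pE]]]|p0].
  have q_ex i : exists q, q \is i.+1.-homog /\ f i = phi q.
    by have [q qi fE] := (grE _ _).1 (f_gr i); exists q.
  have [q qP] := boolp.choice q_ex.
  have -> : NF p = NF (\sum_(i < k) q i).
    by apply/phi_eq; rewrite pE rmorph_sum; apply: eq_bigr => i _; have [] := qP i.
  apply: memN_msupp_eq0; apply/negP => /msupp_relabel[m mq /(congr1 mdeg)].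
  rewrite mdeg0 mdeg_nf; move: mq => /msupp_sum_le/flatten_mapP[i _].
  by have [/dhomog_mf h _] := qP i => /h /= ->.
have -> : phi p = phi (NF p) by apply/phi_eq; rewrite NF_NF.
(* These are the homogeneous components of positive degree; the one of degree 0 is the constant
   term, which vanishes. *)
exists (msize (NF p)), (fun i => phi (pihomog mdeg i.+1 (NF p))); split=> [i|].
  by apply/grE; exists (pihomog mdeg i.+1 (NF p)) => //; apply: pihomogP.
rewrite -rmorph_sum {1}(pihomog_partitionE (leqnSn (msize (NF p)))) big_ord_recl.
rewrite [pihomog _ _ _]big1 ?add0r // => m; rewrite mdeg_eq0 => /eqP ->.
by rewrite p0 scale0r.
Qed.

(** Row vectors lift along [phi], and two lifts of one vector differ by a [null] vector, so
    exactness descends to [A]. *)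
Lemma koszul_of_nf : koszul gr.
Proof.
have lift b (v : 'rV[A]_b) : exists V, v = map_mx phi V.
  have [V VE] := boolp.choice (fun k => phi_surj (v 0 k)).
  by exists (\row_k V k); apply/rowP => k; rewrite !mxE -VE.
have map_null b (V W : 'rV[S]_b) : map_mx phi V = map_mx phi W <-> null (V - W).
  split=> [/rowP VW k|VW].
    by have := VW k; rewrite !mxE linearB /= => /phi_eq ->; rewrite subrr.
  apply/rowP => k; rewrite !mxE; apply/phi_eq/eqP; rewrite -subr_eq0.
  by have := VW k; rewrite rowBE linearB /= => ->.
have image b b' (D : 'M[S]_(b', b)) V :
    (exists w, map_mx phi V = w *m map_mx phi D) <-> exists W, null (V - W *m D).
  split=> [[w]|[W /map_null]]; last by rewrite map_mxM; exists (map_mx phi W).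
  by have [W ->] := lift _ w; rewrite -map_mxM => /map_null; exists W.
have [b [d [b0 d_homog d0 d_exact]]] := linear_resolution.
exists b, (fun i => map_mx phi (d i)); split=> //.
- by move=> i r c; apply/grE; exists (d i r c); rewrite ?mxE.
- move=> v; have [V ->] := lift _ v.
  apply: iff_trans (image _ _ _ _) _; apply: iff_trans (d0 V) _.
  by split=> h j; have := h j; rewrite mxE => /irrelevant_ideal_phi.
- move=> i v; have [V ->] := lift _ v.
  apply: iff_trans (iff_sym (image _ _ _ _)).
  apply: iff_trans (d_exact i V).
  by rewrite -map_mxM -(map_mx0 phi); rewrite map_null subr0.
Qed.

End NormalForm.

(** * Multidegrees of products of cells *)

Section NestedProducts.
Local Open Scope nat_scope.
Context (R C N n : nat) (row : 'I_n -> 'I_R) (col : 'I_n -> 'I_C) (lay : 'I_n -> 'I_N.+1).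
Context (cell : 'I_R -> 'I_C -> 'I_n) (rho : 'I_R -> nat) (gam : 'I_C -> nat).
Hypothesis row_cell : forall i j, row (cell i j) = i.
Hypothesis col_cell : forall i j, col (cell i j) = j.
Hypothesis cell_row_col : forall k, cell (row k) (col k) = k.
Hypothesis layE : forall k, lay k = maxn (rho (row k)) (gam (col k)) :> nat.

Local Notation dim := (R + C + N.+1).
Definition u_idx (i : 'I_R) : 'I_dim := lshift N.+1 (lshift C i).
Definition v_idx (j : 'I_C) : 'I_dim := lshift N.+1 (rshift R j).
Definition w_idx (l : 'I_N.+1) : 'I_dim := rshift (R + C) l.

Definition cell_exp (k : 'I_n) : 'X_{1..dim} :=
  (U_(u_idx (row k)) + U_(v_idx (col k)) + U_(w_idx (lay k)))%MM.

Definition fiber_exp (m : 'X_{1..n}) : 'X_{1..dim} := (\sum_k cell_exp k *+ m k)%MM.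

Lemma fiber_expD m1 m2 : fiber_exp (m1 + m2)%MM = (fiber_exp m1 + fiber_exp m2)%MM.
Proof.
rewrite /fiber_exp -big_split /=; apply: eq_bigr => k _.
by apply/mnmP => x; rewrite !(mulmnE, mnmDE) mulnDr.
Qed.

Lemma fiber_expU k : fiber_exp U_(k)%MM = cell_exp k.
Proof.
rewrite /fiber_exp (bigD1 k) //= big1 => [|k' ne].
  by rewrite mnm1E eqxx mulm1n addm0.
by rewrite mnm1E eq_sym (negPf ne) mulm0n.
Qed.

Lemma idxE : (forall i i', (u_idx i == u_idx i') = (i == i')) *
  (forall j j', (v_idx j == v_idx j') = (j == j')) *
  (forall l l', (w_idx l == w_idx l') = (l == l')) *
  (forall i j, (u_idx i == v_idx j) = false) * (forall i j, (v_idx j == u_idx i) = false) *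
  (forall i l, (u_idx i == w_idx l) = false) * (forall i l, (w_idx l == u_idx i) = false) *
  (forall j l, (v_idx j == w_idx l) = false) * (forall j l, (w_idx l == v_idx j) = false).
Proof.
by do !split=> *; rewrite /u_idx /v_idx /w_idx ?(eq_lshift, eq_rshift, eq_lrshift, eq_rlshift).
Qed.

Lemma cell_expE : (forall k i, cell_exp k (u_idx i) = (row k == i)) *
  (forall k j, cell_exp k (v_idx j) = (col k == j)) *
  (forall k l, cell_exp k (w_idx l) = (lay k == l)).
Proof. by do !split=> *; rewrite !mnmDE !mnm1E !idxE ?addn0. Qed.

Lemma sum_delta (T : finType) (P : pred T) x : \sum_(i | P i) (x == i) = P x.
Proof.
rewrite big_mkcond (bigD1 x) //= eqxx big1 ?addn0 => [|i /negPf]; first by case: (P x).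
by rewrite eq_sym => ->; case: (P i).
Qed.

Lemma fiber_expE m x : fiber_exp m x = \sum_k cell_exp k x * m k.
Proof. by rewrite mnm_sumE; apply: eq_bigr => k _; rewrite mulmnE. Qed.

(** The multidegree thus fixes how many cells have a given property of their row, of their column or
    of their layer. *)
Lemma fiber_sum (T : finType) (idx : T -> 'I_dim) (f : 'I_n -> T) (P : pred T) m :
  (forall k t, cell_exp k (idx t) = (f k == t)) ->
  \sum_(t | P t) fiber_exp m (idx t) = \sum_(k | P (f k)) m k.
Proof.
move=> fE; under eq_bigr do rewrite fiber_expE.
rewrite exchange_big [RHS]big_mkcond; apply: eq_bigr => k _ /=.
under eq_bigr do rewrite fE.
by rewrite -big_distrl sum_delta /=; case: (P _); rewrite ?mul1n.
Qed.

(** Level first, index second: since [i < R], this is a lexicographic rank. *)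
Definition row_rank i := rho i * R + i.
Definition col_rank j := gam j * C + j.

Lemma row_rank_inj : injective row_rank.
Proof.
move=> i i' /(congr1 (modn^~ R)); rewrite /row_rank !modnMDl !modn_small //.
exact: val_inj.
Qed.

Lemma col_rank_inj : injective col_rank.
Proof.
move=> i i' /(congr1 (modn^~ C)); rewrite /col_rank !modnMDl !modn_small //.
exact: val_inj.
Qed.

Lemma row_rank_lt i i' : rho i < rho i' -> row_rank i < row_rank i'.
Proof.
move=> lt_i; apply: leq_trans (leq_addr _ _).
by rewrite (leq_trans _ (leq_mul lt_i (leqnn R))) // mulSnr ltn_add2l.
Qed.

Lemma col_rank_lt j j' : gam j < gam j' -> col_rank j < col_rank j'.
Proof.
move=> lt_j; apply: leq_trans (leq_addr _ _).
by rewrite (leq_trans _ (leq_mul lt_j (leqnn C))) // mulSnr ltn_add2l.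
Qed.

(* For cells in increasing position, the last condition says that exchanging their
   columns preserves the multiset of layers; see [swap_fiber]. *)
Definition forb k k' :=
  [&& row_rank (row k) < row_rank (row k'), col_rank (col k) < col_rank (col k')
    & minn (rho (row k')) (gam (col k')) <= lay k].

Lemma forb_irr k : ~~ forb k k.
Proof. by rewrite /forb ltnn. Qed.

Definition weight (m : 'X_{1..n}) := \sum_k m k * (row_rank (row k) * col_rank (col k)).

(* The total degree of [enc m] is [weight m + mdeg m], and total degree is compared
   first. *)
Definition enc (m : 'X_{1..n}) : 'X_{1..n.+1} :=
  [multinom if unlift ord0 x is Some k then m k else weight m | x < n.+1].

Lemma encD m1 m2 : enc (m1 + m2)%MM = (enc m1 + enc m2)%MM.
Proof.
apply/mnmP => x; rewrite mnmDE !mnmE; case: (unlift _ _) => [k|]; first by rewrite mnmDE.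
by rewrite /weight -big_split; apply: eq_bigr => k _; rewrite mnmDE mulnDl.
Qed.

Lemma enc_inj : injective enc.
Proof.
move=> m1 m2 /mnmP E; apply/mnmP => k.
by have := E (lift ord0 k); rewrite !mnmE liftK.
Qed.

Lemma mdeg_enc m : mdeg (enc m) = weight m + mdeg m.
Proof.
rewrite !mdegE big_ord_recl mnmE unlift_none; congr (_ + _).
by apply: eq_bigr => k _; rewrite mnmE liftK.
Qed.

Definition swap1 k k' := cell (row k) (col k').

Lemma swap_fiber k k' : forb k k' ->
  fiber_exp (U_(k) + U_(k'))%MM = fiber_exp (U_(swap1 k k') + U_(swap1 k' k))%MM.
Proof.
case/and3P=> lt_row lt_col le_min.
have le_rho : rho (row k) <= rho (row k').
  by rewrite leqNgt; apply/negP => /row_rank_lt; lia.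
have le_gam : gam (col k) <= gam (col k').
  by rewrite leqNgt; apply/negP => /col_rank_lt; lia.
(* The condition on the minimum puts one exchanged cell into the layer of [k]; the other one is then
   in the layer of [k']. *)
have lays : (lay (swap1 k k') = lay k /\ lay (swap1 k' k) = lay k') \/
            (lay (swap1 k k') = lay k' /\ lay (swap1 k' k) = lay k).
  have h1 := layE (swap1 k k'); have h2 := layE (swap1 k' k).
  rewrite !(row_cell, col_cell) in h1 h2; rewrite layE in le_min.
  have h3 := layE k; have h4 := layE k'.
  have : (lay (swap1 k k') = lay k :> nat /\ lay (swap1 k' k) = lay k' :> nat) \/
            (lay (swap1 k k') = lay k' :> nat /\ lay (swap1 k' k) = lay k :> nat) by lia.
  by case=> -[/val_inj ? /val_inj ?]; [left|right].
rewrite !fiber_expD !fiber_expU /cell_exp !row_cell !col_cell.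
apply/mnmP => x; rewrite !mnmDE.
by case: lays => -[-> ->]; lia.
Qed.

Lemma weightD m1 m2 : weight (m1 + m2)%MM = weight m1 + weight m2.
Proof. by rewrite /weight -big_split; apply: eq_bigr => k _; rewrite mnmDE mulnDl. Qed.

Lemma weightU k : weight U_(k)%MM = row_rank (row k) * col_rank (col k).
Proof.
rewrite /weight (bigD1 k) //= mnm1E eqxx mul1n big1 ?addn0 // => k' ne.
by rewrite mnm1E eq_sym (negPf ne).
Qed.

(** The rearrangement inequality: a product of ranks is larger when both factors are paired in
    increasing order. *)
Lemma swap_lt k k' : forb k k' ->
  (enc (U_(swap1 k k') + U_(swap1 k' k))%MM < enc (U_(k) + U_(k'))%MM)%O.
Proof.
case/and3P=> lt_row lt_col _; apply: lt_mdeg_ltmc; rewrite !mdeg_enc !mdegD !mdeg1.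
by rewrite !weightD !weightU !row_cell !col_cell; nia.
Qed.

(** * Existence and uniqueness of the standard monomial in a multidegree *)

Definition standard (m : 'X_{1..n}) :=
  [forall k, forall k', (0 < m k) && (0 < m k') ==> ~~ forb k k'].

Lemma standardP (m : 'X_{1..n}) :
  reflect (forall k k', 0 < m k -> 0 < m k' -> ~~ forb k k') (standard m).
Proof.
apply: (iffP forallP) => [h k k' mk mk'|h k].
  by have /forallP/(_ k')/implyP := h k; apply; rewrite mk.
by apply/forallP => k'; apply/implyP => /andP[]; apply: h.
Qed.

Lemma forb_neq k k' : forb k k' -> k != k'.
Proof. by apply: contraTneq => ->; apply: forb_irr. Qed.

(** Exchange forbidden pairs as long as there are any; every exchange lowers [enc], and the order is
    well-founded. *)
Lemma standardize (m : 'X_{1..n}) :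
  exists m', [/\ standard m', fiber_exp m' = fiber_exp m & (enc m' <= enc m)%O].
Proof.
move: {-1}(enc m) (erefl (enc m)) => E; elim/(@ltmwf n.+1): E m => E IH m mE.
have [std|] := boolP (standard m); first by exists m; rewrite std mE.
case/forallPn=> k /forallPn[k']; rewrite negb_imply negbK => /andP[/andP[mk mk'] f].
have le_m : (U_(k) + U_(k') <= m)%MM.
  apply/mnm_lepP => x; rewrite mnmDE !mnm1E.
  case: (eqVneq k x) (eqVneq k' x) => [kx|_] [k'x|_] //; try by subst x.
  by have := forb_neq f; rewrite kx k'x eqxx.
have mD : m = (m - (U_(k) + U_(k')) + (U_(k) + U_(k')))%MM by rewrite submK.
set m0 := (m - _)%MM in mD.
pose m1 := (m0 + (U_(swap1 k k') + U_(swap1 k' k)))%MM.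
have lt_m1 : (enc m1 < E)%O by rewrite -mE mD !(encD m0) ltmc_add2r swap_lt.
have [m' [std f' le_m']] := IH _ lt_m1 m1 erefl; exists m'; split=> //.
  by rewrite f' mD /m1 !(fiber_expD m0) (swap_fiber f).
by rewrite (le_trans le_m') ?ltW // mE.
Qed.

Lemma fiber_layer_sum (T : finType) (idx : T -> 'I_dim) (f : 'I_n -> T) (P : pred T) m1 m2 :
  (forall k t, cell_exp k (idx t) = (f k == t)) -> fiber_exp m1 = fiber_exp m2 ->
  \sum_(k | P (f k)) m1 k = \sum_(k | P (f k)) m2 k.
Proof. by move=> fE E; rewrite -!(fiber_sum _ _ fE) E. Qed.

Section Uniqueness.
Variables (m1 m2 : 'X_{1..n}).
Hypotheses (std1 : standard m1) (std2 : standard m2) (fibE : fiber_exp m1 = fiber_exp m2).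

(* Both monomials have as many cells of rank at least that of [col k2] among the
   columns of level at most [l].  In [m2] all cells of the layer [l] are such cells;
   in [m1] such cells have layer [l], and if [col k1] came before [col k2], then [k1]
   would be missing among them. *)
Lemma first_layer_column (l : nat) k1 k2 :
  (forall k, 0 < m1 k -> l <= lay k) ->
  (forall k, 0 < m2 k -> lay k = l :> nat -> row_rank (row k) <= row_rank (row k2)) ->
  0 < m1 k1 -> 0 < m2 k2 -> lay k1 = l :> nat -> lay k2 = l :> nat -> row k1 = row k2 ->
  (forall k, 0 < m2 k -> lay k = l :> nat -> row k = row k2 ->
     col_rank (col k2) <= col_rank (col k)) ->
  col_rank (col k2) <= col_rank (col k1).
Proof.
move=> minl max_row m1k1 m2k2 l1 l2 row12 min_col; rewrite leqNgt; apply/negP => lt_col.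
pose P j := (col_rank (col k2) <= col_rank j) && (gam j <= l).
have colE := fiber_layer_sum P (fun k j => (cell_expE.1.2 k j)) fibE.
have layE' := fiber_layer_sum (fun t : 'I_N.+1 => t == l :> nat) (fun k t => cell_expE.2 k t) fibE.
have le2 : \sum_(k | lay k == l :> nat) m2 k <= \sum_(k | P (col k)) m2 k.
  rewrite [leqLHS]big_mkcond [leqRHS]big_mkcond; apply: leq_sum => k _.
  case: eqP => // lk; case: (posnP (m2 k)) => [->|m2k]; first by case: (P _).
  suff -> : P (col k) by [].
  rewrite /P -lk layE leq_maxr andbT.
  have := max_row k m2k lk; rewrite leq_eqVlt.
  case/predU1P=> [/row_rank_inj|lt_row]; first exact: min_col.
  (* Two cells of one layer in increasing position are always forbidden, since the minimum of two
     levels is at most their maximum. *)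
  rewrite leqNgt; apply/negP => lt_c.
  have := (standardP _ std2) k k2 m2k m2k2; rewrite /forb lt_row lt_c /= lk -l2 layE; lia.
have lt1 : \sum_(k | P (col k)) m1 k < \sum_(k | lay k == l :> nat) m1 k.
  rewrite [ltnRHS](bigD1 k1) ?l1 //= -add1n leq_add //.
  rewrite [leqLHS]big_mkcond [leqRHS]big_mkcond; apply: leq_sum => k _.
  case: ifP => // /andP[le_col le_gam]; case: (posnP (m1 k)) => [->//|m1k].
  have -> : k != k1 by apply: contraTneq le_col => ->; rewrite -ltnNge.
  have := minl k m1k; rewrite leq_eqVlt => /predU1P[<-|lt_l]; first by rewrite eqxx.
  (* In a later layer, such a cell would owe its layer to its row and form a forbidden pair with
     [k1]. *)
  have h1 := layE k; have h2 := layE k1.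
  have lt_rho : rho (row k1) < rho (row k) by lia.
  have := (standardP _ std1) k1 k m1k1 m1k.
  rewrite /forb row_rank_lt // (leq_trans lt_col) //=; lia.
by move: lt1; rewrite colE layE' ltnNge le2.
Qed.

End Uniqueness.

(** A cell of row [i] in a later layer would have column level above [l] and form a forbidden pair
    with [k0]. *)
Lemma first_layer_row (m : 'X_{1..n}) (l : nat) k0 i : standard m ->
  (forall k, 0 < m k -> l <= lay k) -> 0 < m k0 -> lay k0 = l :> nat ->
  rho i <= l -> row_rank (row k0) <= row_rank i -> 0 < fiber_exp m (u_idx i) ->
  exists k, [/\ 0 < m k, lay k = l :> nat & row k = i].
Proof.
move=> std minl mk0 lk0 le_i; rewrite leq_eqVlt => /predU1P[/row_rank_inj <- _|lt_i].
  by exists k0.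
rewrite fiber_expE => /lt0n_neq0; rewrite sum_nat_eq0 => /forallPn[k].
rewrite cell_expE.1.1 /= muln_eq0 negb_or eqb0 negbK -lt0n => /andP[/eqP ki] mk.
exists k; split=> //. apply/eqP; rewrite eqn_leq minl // andbT leqNgt; apply/negP => lt_l.
have h1 := layE k; have h2 := layE k0; subst i.
have := (standardP _ std) k0 k mk0 mk; rewrite /forb lt_i col_rank_lt /=; lia.
Qed.

(** In the first layer, take the largest row and in it the smallest column; [first_layer_column],
    applied both ways, shows that the two columns agree. *)
Lemma common_cell m1 m2 : standard m1 -> standard m2 -> fiber_exp m1 = fiber_exp m2 ->
  m1 != 0%MM -> exists k, (0 < m1 k) && (0 < m2 k).
Proof.
move=> std1 std2 fibE m1_neq0.
have [k0 mk0] : exists k, 0 < m1 k.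
  apply/existsP; apply: contraR m1_neq0 => /existsPn h; apply/eqP/mnmP => k.
  by rewrite mnm0E; apply/eqP; rewrite -leqn0 leqNgt h.
have [k1 m1k1 min1] := @arg_minnP _ k0 (fun k => 0 < m1 k) (fun k => lay k : nat) mk0.
set l : nat := lay k1 in min1.
have lay_ex m m' k : fiber_exp m = fiber_exp m' -> 0 < m k ->
    exists2 k', 0 < m' k' & lay k' = lay k.
  move=> E mk; have : 0 < fiber_exp m' (w_idx (lay k)).
    by rewrite -E fiber_expE (bigD1 k) //= cell_expE.2 eqxx mul1n addn_gt0 mk.
  rewrite fiber_expE => /lt0n_neq0; rewrite sum_nat_eq0 => /forallPn[k'].
  rewrite cell_expE.2 /= muln_eq0 negb_or eqb0 negbK -lt0n => /andP[/eqP ki] mk'.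
  by exists k'.
have [k2 m2k2 lk2] := lay_ex _ _ _ fibE m1k1.
have min2 k : 0 < m2 k -> l <= lay k.
  by move/(lay_ex _ _ _ (esym fibE)) => [k' /min1 + <-].
(* [Q] depends only on the common multidegree, so its maximal row serves both monomials. *)
pose Q i := (rho i <= l) && (0 < fiber_exp m1 (u_idx i)).
have row_Q m k : fiber_exp m = fiber_exp m1 -> 0 < m k -> lay k = l :> nat -> Q (row k).
  move=> E mk lk; rewrite /Q -E -lk layE leq_maxl fiber_expE (bigD1 k) //=.
  by rewrite cell_expE.1.1 eqxx mul1n addn_gt0 mk.
have [i /andP[rho_i e_i] max_i] := @arg_maxnP _ (row k1) Q row_rank (row_Q m1 k1 erefl m1k1 erefl).
have pick m k : standard m -> fiber_exp m = fiber_exp m1 -> (forall k', 0 < m k' -> l <= lay k') ->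
    0 < m k -> lay k = l :> nat ->
    exists k', [/\ 0 < m k', lay k' = l :> nat, row k' = i &
      forall k'', 0 < m k'' -> lay k'' = l :> nat -> row k'' = i ->
        col_rank (col k') <= col_rank (col k'')].
  move=> std E minm mk lk.
  have [|a [ma la ra]] := first_layer_row std minm mk lk rho_i (max_i _ (row_Q _ _ E mk lk)).
    by rewrite E.
  pose P k := [&& 0 < m k, lay k == l :> nat & row k == i].
  have Pa : P a by rewrite /P ma la ra !eqxx.
  have [k' /and3P[mk' /eqP lk' /eqP rk'] mink'] :=
    @arg_minnP _ a P (fun k => col_rank (col k)) Pa.
  by exists k'; split=> // k'' m'' /eqP l'' /eqP r''; apply: mink'; rewrite /P m'' l''.
have [a [m1a la ra mina]] := pick m1 k1 std1 erefl min1 m1k1 erefl.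
have [b [m2b lb rb minb]] := pick m2 k2 std2 (esym fibE) min2 m2k2 (congr1 val lk2).
have max1 k : 0 < m1 k -> lay k = l :> nat -> row_rank (row k) <= row_rank i.
  by move=> mk lk; apply/max_i/(row_Q m1).
have max2 k : 0 < m2 k -> lay k = l :> nat -> row_rank (row k) <= row_rank i.
  by move=> mk lk; apply/max_i/(row_Q m2).
have leb : col_rank (col b) <= col_rank (col a).
  by apply: (first_layer_column std1 std2 fibE (l := l)) => //; rewrite ?rb.
have lea : col_rank (col a) <= col_rank (col b).
  by apply: (first_layer_column std2 std1 (esym fibE) (l := l)) => //; rewrite ?ra.
have ab : a = b.
  rewrite -(cell_row_col a) -(cell_row_col b) ra rb; congr cell.
  by apply/col_rank_inj/eqP; rewrite eqn_leq lea.
by exists a; rewrite m1a ab.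
Qed.

Lemma mdeg_fiber m : mdeg (fiber_exp m) = 3 * mdeg m.
Proof.
rewrite mdeg_sum mdegE big_distrr; apply: eq_bigr => k _.
by rewrite mdegMn !mdegD !mdeg1.
Qed.

(** Cancel a common cell and induct on the degree. *)
Lemma standard_inj m1 m2 : standard m1 -> standard m2 -> fiber_exp m1 = fiber_exp m2 -> m1 = m2.
Proof.
have [d led] := ubnP (mdeg m1); elim: d => // d IH in m1 m2 led *.
move=> std1 std2 E; have [m1_0|m1_neq0] := eqVneq m1 0%MM.
  have := mdeg_fiber m2; rewrite -E mdeg_fiber m1_0 mdeg0 muln0 => /esym/eqP.
  by rewrite muln_eq0 /= mdeg_eq0 => /eqP.
have [k /andP[mk1 mk2]] := common_cell std1 std2 E m1_neq0.
have sub (m : 'X_{1..n}) : 0 < m k -> m = (m - U_(k) + U_(k))%MM.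
  by move=> mk; rewrite submK // lep1mP -lt0n.
have std_sub (m : 'X_{1..n}) : standard m -> standard (m - U_(k))%MM.
  by move=> std; apply/standardP => a b; rewrite !mnmBE => ma mb; apply: (standardP _ std); lia.
rewrite (sub _ mk1) (sub _ mk2); congr (_ + _)%MM; apply: IH; rewrite ?std_sub //.
  by move: led; rewrite {1}(sub _ mk1) mdegD mdeg1 addn1 ltnS.
by move: E; rewrite {1}(sub _ mk1) {1}(sub _ mk2) !fiber_expD => /addIm.
Qed.

(** * The cone of multidegrees and its lattice points *)

Definition dot (alpha : 'I_dim -> nat) (e : 'X_{1..dim}) := \sum_x alpha x * e x.

Lemma dotD alpha e1 e2 : dot alpha (e1 + e2)%MM = dot alpha e1 + dot alpha e2.
Proof. by rewrite /dot -big_split; apply: eq_bigr => x _; rewrite mnmDE mulnDr. Qed.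

Lemma dotMn alpha e k : dot alpha (e *+ k)%MM = dot alpha e * k.
Proof. by rewrite /dot big_distrl; apply: eq_bigr => x _; rewrite mulmnE mulnA. Qed.

(* [e] satisfies every linear inequality with natural coefficients that holds on the
   multidegrees of the cells. *)
Definition cell_cone (e : 'X_{1..dim}) := forall alpha beta : 'I_dim -> nat,
  (forall k, dot alpha (cell_exp k) <= dot beta (cell_exp k)) -> dot alpha e <= dot beta e.

Lemma fiber_cone m : cell_cone (fiber_exp m).
Proof.
move=> a b ab; have dotE c : dot c (fiber_exp m) = \sum_k dot c (cell_exp k) * m k.
  rewrite /dot; under eq_bigr do rewrite fiber_expE big_distrr.
  rewrite exchange_big; apply: eq_bigr => k _; rewrite big_distrl.
  by apply: eq_bigr => x _; rewrite /= mulnA.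
by rewrite !dotE; apply: leq_sum => k _; rewrite leq_mul2r ab orbT.
Qed.

(** Inequalities of the cone hold at e1 - e2 because, up to the fixed [d], they hold at all its
    multiples. *)
Lemma cone_saturated d e1 e2 :
  (forall k, exists2 h, cell_cone h & (d + e1 *+ k = h + e2 *+ k)%MM) ->
  exists2 e, cell_cone e & e1 = (e + e2)%MM.
Proof.
move=> H; have sat a b : (forall h, cell_cone h -> dot a h <= dot b h) ->
    dot a e1 + dot b e2 <= dot b e1 + dot a e2.
  move=> ab; rewrite leqNgt; apply/negP => lt_ab.
  (* Multiplied by more than [dot b d], the gap [lt_ab] exceeds what [d] can compensate. *)
  have [h /ab le_h /[dup] /(congr1 (dot a)) + /(congr1 (dot b))] := H (dot b d).+1.
  rewrite !dotD !dotMn; nia.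
(* Nonnegativity of a coordinate is itself an inequality between functionals: 0 against that
   coordinate. *)
have e21 : (e2 <= e1)%MM.
  apply/mnm_lepP => x.
  have dotx e : dot (fun y => y == x) e = e x.
    rewrite /dot (bigD1 x) //= eqxx mul1n big1 ?addn0 // => y /negPf ->.
    by rewrite mul0n.
  have dot0 e : dot (fun=> 0) e = 0 by rewrite /dot big1.
  have := sat (fun=> 0) (fun y => y == x); rewrite !dotx !dot0 addn0; apply=> h _.
  by rewrite dot0.
exists (e1 - e2)%MM; last by rewrite submK.
move=> a b ab; have := sat a b (fun h hQ => hQ _ _ ab).
by rewrite -{1 2}(submK e21) !dotD; lia.
Qed.

Section Mass.
Variables (pu : pred 'I_R) (pv : pred 'I_C) (pw : pred 'I_N.+1).

Definition mass (e : 'X_{1..dim}) :=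
  \sum_(i | pu i) e (u_idx i) + \sum_(j | pv j) e (v_idx j) + \sum_(l | pw l) e (w_idx l).

Definition mass_weight (x : 'I_dim) : nat :=
  match split x with
  | inl y => match split y with inl i => pu i | inr j => pv j end
  | inr l => pw l
  end.

Lemma dot_mass e : dot mass_weight e = mass e.
Proof.
rewrite /dot /mass !big_split_ord /= /mass_weight; congr (_ + _ + _); rewrite [RHS]big_mkcond;
  apply: eq_bigr => x _.
- by rewrite (unsplitK (inl _)) (unsplitK (inl _)); case: (pu x); rewrite ?mul1n.
- by rewrite (unsplitK (inl _)) (unsplitK (inr _)); case: (pv x); rewrite ?mul1n.
- by rewrite (unsplitK (inr _)); case: (pw x); rewrite ?mul1n.
Qed.

Lemma mass_cell k : mass (cell_exp k) = pu (row k) + pv (col k) + pw (lay k).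
Proof.
rewrite /mass; congr (_ + _ + _); rewrite -sum_delta; apply: eq_bigr => x _; by rewrite cell_expE.
Qed.

End Mass.

Lemma cone_mass e (pu : pred 'I_R) (pv : pred 'I_C) (pw : pred 'I_N.+1)
    (pu' : pred 'I_R) (pv' : pred 'I_C) (pw' : pred 'I_N.+1) : cell_cone e ->
  (forall k, pu (row k) + pv (col k) + pw (lay k) <= pu' (row k) + pv' (col k) + pw' (lay k)) ->
  mass pu pv pw e <= mass pu' pv' pw' e.
Proof.
by move=> cone_e H; rewrite -!dot_mass; apply: cone_e => k; rewrite !dot_mass !mass_cell.
Qed.

(** Counting constraints: a cell of layer [l] uses a row or a column of level [l], and a cell of
    layer at most [l] uses a row and a column of level at most [l]. *)
Record feasible (e : 'X_{1..dim}) : Prop := Feasible {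
  feas_row : \sum_i e (u_idx i) = \sum_l e (w_idx l);
  feas_col : \sum_j e (v_idx j) = \sum_l e (w_idx l);
  feas_lay : forall l : 'I_N.+1, e (w_idx l) <=
    \sum_(i | rho i == l) e (u_idx i) + \sum_(j | gam j == l) e (v_idx j);
  feas_row_le : forall l : 'I_N.+1, \sum_(l' : 'I_N.+1 | l' <= l) e (w_idx l') <=
    \sum_(i | rho i <= l) e (u_idx i);
  feas_col_le : forall l : 'I_N.+1, \sum_(l' : 'I_N.+1 | l' <= l) e (w_idx l') <=
    \sum_(j | gam j <= l) e (v_idx j) }.

Lemma cone_feasible e : cell_cone e -> feasible e.
Proof.
move=> /cone_mass C_e; split.
- apply/eqP; rewrite eqn_leq.
  have := C_e predT pred0 pred0 pred0 pred0 predT; have := C_e pred0 pred0 predT predT pred0 pred0.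
  by rewrite /mass !big_pred0_eq !addn0 !add0n => h1 h2; apply/andP; split; [apply: h2|apply: h1].
- apply/eqP; rewrite eqn_leq.
  have := C_e pred0 predT pred0 pred0 pred0 predT; have := C_e pred0 pred0 predT pred0 predT pred0.
  by rewrite /mass !big_pred0_eq !addn0 !add0n => h1 h2; apply/andP; split; [apply: h2|apply: h1].
- move=> l; have := C_e pred0 pred0 (pred1 l) (fun i => rho i == l) (fun j => gam j == l) pred0.
  rewrite /mass !big_pred0_eq !addn0 !add0n big_pred1_eq; apply=> k.
  rewrite /= -val_eqE /= layE; lia.
- move=> l; have := C_e pred0 pred0 (fun l' : 'I_N.+1 => l' <= l) (fun i => rho i <= l) pred0 pred0.
  rewrite /mass !big_pred0_eq !addn0 !add0n; apply=> k /=; rewrite layE; lia.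
- move=> l; have := C_e pred0 pred0 (fun l' : 'I_N.+1 => l' <= l) pred0 (fun j => gam j <= l) pred0.
  rewrite /mass !big_pred0_eq !addn0 !add0n; apply=> k /=; rewrite layE; lia.
Qed.

(* The cell is taken in the first layer l: in a row of level l if there is one, with a
   column of level less than l if possible. *)
Lemma feasible_cell e : feasible e -> 0 < \sum_l e (w_idx l) ->
  exists2 k, (cell_exp k <= e)%MM & feasible (e - cell_exp k)%MM.
Proof.
case=> F1 F2 F3 F4 F5 tot.
have pos (T : finType) (P : pred T) (f : T -> nat) : 0 < \sum_(t | P t) f t ->
    exists t, P t && (0 < f t).
  move=> s0; apply/existsP; apply: contraLR s0 => /existsPn none; rewrite -eqn0Ngt.
  rewrite sum_nat_eq0; apply/forallP => t; apply/implyP => Pt.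
  by have := none t; rewrite Pt /= -eqn0Ngt.
have [l0 e_l0] := pos _ predT _ tot.
have [l e_l min_l] := @arg_minnP _ l0 (fun l : 'I_N.+1 => 0 < e (w_idx l)) (fun l => l : nat) e_l0.
have e_lt (l' : 'I_N.+1) : l' < l -> e (w_idx l') = 0.
  by move=> lt_l; apply/eqP; rewrite eqn0Ngt; apply: contraTN lt_l => /min_l; rewrite -leqNgt.
have D_l : \sum_(l' : 'I_N.+1 | l' <= l) e (w_idx l') = e (w_idx l).
  rewrite (bigD1 l) //= big1 ?addn0 // => l' /andP[le_l ne].
  by rewrite e_lt // ltn_neqAle ne.
(* [both] is the slack needed when row and column have level [l]: removing the cell lowers the right
   side of [feas_lay] by two, the left by one. *)
have [k [row_k col_k lay_k both]] : exists k, [/\ 0 < e (u_idx (row k)), 0 < e (v_idx (col k)),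
    lay k = l & rho (row k) = l -> gam (col k) = l ->
    e (w_idx l) < \sum_(i | rho i == l) e (u_idx i) + \sum_(j | gam j == l) e (v_idx j)].
  have mk i j : 0 < e (u_idx i) -> 0 < e (v_idx j) -> maxn (rho i) (gam j) = l ->
      (rho i = l -> gam j = l -> e (w_idx l) <
        \sum_(i | rho i == l) e (u_idx i) + \sum_(j | gam j == l) e (v_idx j)) ->
      exists k, [/\ 0 < e (u_idx (row k)), 0 < e (v_idx (col k)), lay k = l &
        rho (row k) = l -> gam (col k) = l -> e (w_idx l) <
        \sum_(i | rho i == l) e (u_idx i) + \sum_(j | gam j == l) e (v_idx j)].
    move=> ei ej ij lt; exists (cell i j); rewrite row_cell col_cell; split=> //.
    by apply: val_inj; rewrite /= layE row_cell col_cell.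
  have [i0 /andP[le_i0 e_i0]] : exists i, (rho i <= l) && (0 < e (u_idx i)).
    by apply: pos; apply: leq_trans (F4 l); rewrite D_l.
  have [j0 /andP[le_j0 e_j0]] : exists j, (gam j <= l) && (0 < e (v_idx j)).
    by apply: pos; apply: leq_trans (F5 l); rewrite D_l.
  have [p0|/pos[i /andP[/eqP i_l e_i]]] := posnP (\sum_(i | rho i == l) e (u_idx i)).
    have /pos[j /andP[/eqP j_l e_j]] : 0 < \sum_(j | gam j == l) e (v_idx j).
      by apply: leq_trans e_l _; have := F3 l; rewrite p0.
    apply: (mk i0 j) => //; first by rewrite j_l; apply/maxn_idPr.
    move=> i0_l; move: p0 => /eqP; rewrite sum_nat_eq0 => /forallP/(_ i0).
    by rewrite i0_l eqxx eqn0Ngt e_i0.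
  have [/existsP[j /andP[lt_j e_j]]|/existsPn none] :=
    boolP [exists j, (gam j < l) && (0 < e (v_idx j))].
    by apply: (mk i j) => //; rewrite i_l; lia.
  have j0_l : gam j0 = l.
    by apply/eqP; rewrite eqn_leq le_j0 leqNgt /=; have := none j0; rewrite e_j0 andbT.
  apply: (mk i j0) => //; rewrite ?i_l ?j0_l ?maxnn // => _ _.
  (* No column below level [l] occurs, so by [F5] the columns of level [l] alone match the layer
     [l], and the row [i] adds one. *)
  rewrite -add1n leq_add //.
    by rewrite (bigD1 i) ?i_l //= addn_gt0 e_i.
  rewrite -D_l; apply: leq_trans (F5 l) _.
  rewrite [leqLHS]big_mkcond [leqRHS]big_mkcond; apply: leq_sum => j _.
  case: ltngtP (none j) => //= _.
  by rewrite -eqn0Ngt => /eqP ->.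
have le_e : (cell_exp k <= e)%MM.
  apply/mnm_lepP => x; rewrite !mnmDE !mnm1E.
  have [<-|_] := eqVneq (u_idx (row k)) x; first by rewrite !idxE.
  have [<-|_] := eqVneq (v_idx (col k)) x; first by rewrite !idxE.
  by have [<-|_] := eqVneq _ x; rewrite ?lay_k.
exists k => //; set e' := (e - _)%MM.
have eE : e = (e' + cell_exp k)%MM by rewrite submK.
have sumE (T : finType) (idx : T -> 'I_dim) (f : 'I_n -> T) (P : pred T) :
  (forall k t, cell_exp k (idx t) = (f k == t)) ->
  \sum_(t | P t) e (idx t) = \sum_(t | P t) e' (idx t) + P (f k).
  move=> fE; rewrite -sum_delta -big_split; apply: eq_bigr => t _.
  by rewrite eE mnmDE fE.
have sumu P := sumE _ _ _ P cell_expE.1.1.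
have sumv P := sumE _ _ _ P cell_expE.1.2.
have sumw P := sumE _ _ _ P cell_expE.2.
have lay_kE := layE k; rewrite lay_k in lay_kE.
have eW l' : e (w_idx l') = e' (w_idx l') + (l == l') by rewrite eE mnmDE cell_expE lay_k.
have e'_lt (l' : 'I_N.+1) : l' < l -> e' (w_idx l') = 0.
  by move=> /e_lt; rewrite eW => /eqP; rewrite addn_eq0 => /andP[/eqP].
have e'_sum0 (l' : 'I_N.+1) : l' < l -> \sum_(l'' : 'I_N.+1 | l'' <= l') e' (w_idx l'') = 0.
  by move=> lt_l; rewrite big1 // => l'' le_l; apply: e'_lt; apply: leq_ltn_trans lt_l.
split.
- by have := F1; rewrite sumu sumw; lia.
- by have := F2; rewrite sumv sumw; lia.
- move=> l'; have := F3 l'; rewrite sumu sumv eW.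
  have [lt_l|lt_l|E] := ltngtP l' l; first by rewrite e'_lt.
    by rewrite -val_eqE /= lay_kE; lia.
  rewrite (val_inj E) eqxx in both *.
  move: both; rewrite sumu sumv eW eqxx.
  have [rl|] := eqVneq (rho (row k)) l; have [gl|] := eqVneq (gam (col k)) l; try lia.
- move=> l'; have := F4 l'; rewrite sumu sumw /= lay_k.
  by have [le_l|/e'_sum0 -> //] := leqP l l'; lia.
- move=> l'; have := F5 l'; rewrite sumv sumw /= lay_k.
  by have [le_l|/e'_sum0 -> //] := leqP l l'; lia.
Qed.

(** Peel off cells while staying feasible; once no layer variable is left, all exponents vanish. *)
Lemma cell_cone_fiber e : cell_cone e -> exists m, e = fiber_exp m.
Proof.
move/cone_feasible; have [d] := ubnP (\sum_l e (w_idx l)).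
elim: d e => // d IH e led feas; have [tot0|] := posnP (\sum_l e (w_idx l)).
  exists 0%MM; apply/mnmP => x; rewrite fiber_expE big1 => [|k _]; last by rewrite mnm0E muln0.
  have [F1 F2 _ _ _] := feas; rewrite tot0 in F1 F2.
  have zero (T : finType) (f : T -> nat) t : \sum_t f t = 0 -> f t = 0.
    by move=> /eqP; rewrite sum_nat_eq0 => /forallP/(_ t)/eqP.
  case: (split_ordP x) => [y ->|l ->]; last exact: (zero _ (fun l => e (w_idx l))).
  case: (split_ordP y) => [i ->|j ->]; first exact: (zero _ (fun i => e (u_idx i))).
  exact: (zero _ (fun j => e (v_idx j))).
move=> /(feasible_cell feas)[k le_k /IH[|m mE]].
  move: led; rewrite ltnS; apply: leq_trans; rewrite -{2}(submK le_k).
  under [X in _ < X]eq_bigr do rewrite mnmDE cell_expE.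
  by rewrite big_split /= sum_delta addn1.
by exists (m + U_(k))%MM; rewrite fiber_expD fiber_expU -mE submK.
Qed.

End NestedProducts.

(** * Normality *)

Lemma fraction_numden (A : idomainType) (u : {fraction A}) :
  exists f g : A, g != 0 /\ u * tofrac g = tofrac f.
Proof.
exists (\n_(repr u)), (\d_(repr u)); split; first exact: denom_ratioP.
rewrite -[u in LHS]reprK; unlock tofrac; rewrite -[LHS]FracField.pi_mul.
apply/eqmodP; rewrite /= FracField.equivfE /FracField.mulf.
by rewrite !numden_Ratio ?mulr1 ?oner_eq0 ?denom_ratioP // reprK mulrC.
Qed.

(** * Common denominators for the powers of a fraction *)

Section AlmostIntegral.
Context (A : idomainType) (D : A).
Local Notation F := {fraction A}.
Local Notation "x %:F" := (@tofrac A x).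

Definition denominator (x : F) := exists h : A, D%:F * x = h%:F.

Lemma denominatorD x y : denominator x -> denominator y -> denominator (x + y).
Proof. by move=> [h1 E1] [h2 E2]; exists (h1 + h2); rewrite mulrDr E1 E2 rmorphD. Qed.

Lemma denominatorM a x : denominator x -> denominator (a%:F * x).
Proof. by move=> [h E]; exists (a * h); rewrite mulrCA E rmorphM. Qed.

Lemma denominator_sum (I : Type) (r : seq I) (P : pred I) (f : I -> F) :
  (forall i, P i -> denominator (f i)) -> denominator (\sum_(i <- r | P i) f i).
Proof.
move=> fD; elim/big_ind: _ => //; last exact: denominatorD.
by exists 0; rewrite mulr0 rmorph0.
Qed.

(** Binomial expansion: the fractions with denominator [D] form an [A]-module, so [D] need not
    change. *)
Lemma denominator_sub u a :
  (forall k, denominator (u ^+ k)) -> forall k, denominator ((u - a%:F) ^+ k).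
Proof.
move=> uD k; rewrite addrC exprDn; apply: denominator_sum => i _.
rewrite -mulr_natr -rmorphN -rmorphXn mulrAC -(rmorph_nat (@tofrac A)) -rmorphM.
exact: denominatorM.
Qed.
End AlmostIntegral.

Lemma integral_denominator (A : idomainType) (u : {fraction A}) (f g : A) :
  integralOver (@tofrac A) u -> g != 0 -> u * tofrac g = tofrac f ->
  exists2 D : A, D != 0 & forall k, denominator D (u ^+ k).
Proof.
move=> [p p_monic pu] g0 ug; set N := (size p).-1.
(* [g ^+ N] clears the powers below [N], and the integral equation reduces the higher ones to
   these. *)
exists (g ^+ N); first exact: expf_neq0.
have uN : u ^+ N = \sum_(i < N) tofrac (- p`_i) * u ^+ i.
  move: pu; rewrite /root horner_coef size_map_poly_id0; last first.
    by rewrite (monicP p_monic) rmorph1 oner_eq0.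
  have -> : size p = N.+1 by rewrite prednK // size_poly_gt0 monic_neq0.
  rewrite big_ord_recr /= coef_map /= -[p`_N]/(lead_coef p) (monicP p_monic) rmorph1 mul1r.
  rewrite addrC addr_eq0 => /eqP ->; rewrite -sumrN; apply: eq_bigr => i _.
  by rewrite coef_map rmorphN mulNr.
elim/ltn_ind => k IH; have [lt_k|le_k] := ltnP k N.
  exists (g ^+ (N - k) * f ^+ k).
  rewrite tofracM !tofracXn -ug exprMn [u ^+ k * _]mulrC mulrA -exprD subnK //.
  exact: ltnW.
rewrite -(subnK le_k) exprD uN mulr_sumr; apply: denominator_sum => i _.
rewrite mulrCA -exprD; apply/denominatorM/IH.
by rewrite -{2}(subnK le_k) ltn_add2l.
Qed.

(** * Normality of subalgebras generated by monomials *)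

Section MonomialSubalgebra.
Context (K : fieldType) (n p : nat) (g : n.-tuple {mpoly K[p]}).
Context (expo : 'X_{1..n} -> 'X_{1..p}) (Q : 'X_{1..p} -> Prop).
Hypothesis g_expo : forall q, q \mPo g = relabel expo q.
Hypothesis Q_expo : forall m, Q (expo m).
Hypothesis expo_Q : forall e, Q e -> exists m, e = expo m.
Hypothesis Q_sat : forall d e1 e2,
  (forall k, exists2 h, Q h & (d + e1 *+ k = h + e2 *+ k)%MM) -> exists2 e, Q e & e1 = (e + e2)%MM.

Local Notation A := (subalgebra g).

Let vM (a b : A) : val (a * b) = val a * val b.
Proof. exact: rmorphM. Qed.

Let vB (a b : A) : val (a - b) = val a - val b.
Proof. exact: rmorphB. Qed.

Let vX (a : A) k : val (a ^+ k) = val a ^+ k.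
Proof. exact: rmorphXn. Qed.

Lemma subalgebra_supp (a : A) m : m \in msupp (val a) -> Q m.
Proof.
have /asboolP[q aE] := subalgebra_valP a.
by rewrite (aE : val a = _) g_expo => /msupp_relabel[m' _ ->].
Qed.

Lemma subalgebra_monomial c e : Q e -> exists a : A, val a = c *: 'X_[e].
Proof.
case/expo_Q=> m ->; have aP : c *: 'X_[expo m] \in in_subalgebra g.
  by apply/asboolP; exists (c *: 'X_[m]); rewrite g_expo linearZ /= relabelX.
by exists (Subalgebra aP).
Qed.

Lemma mlead_sub_lt (f h : {mpoly K[p]}) : mlead f = mlead h ->
  f@_(mlead f) = h@_(mlead h) -> f - h != 0 -> (mlead (f - h) < mlead f)%O.
Proof.
move=> fh lc nz; rewrite lt_neqAle; apply/andP; split.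
  apply: contra_neq nz => E; apply/eqP; rewrite -mleadc_eq0 E mcoeffB lc fh.
  by rewrite subrr.
by apply: le_trans (mleadB_le _ _) _; rewrite -fh joinxx.
Qed.

(* Comparing leading monomials in [D * f ^+ k = h_k * g0 ^+ k] for all k shows that the
   leading monomial of [f] is that of [g0] times a monomial of the subalgebra. *)
Lemma subalgebra_almost_integral (D g0 : A) (u : {fraction A}) (f : A) :
  D != 0 -> g0 != 0 -> (forall k, denominator D (u ^+ k)) ->
  u * tofrac g0 = tofrac f -> exists a : A, u = tofrac a.
Proof.
move=> D0 g00; move E: (mlead (val f)) => e.
elim/(@ltmwf p): e u f E => e IH u f E uD uf.
have g0F : tofrac g0 != 0 by rewrite tofrac_eq0.
have [f0|f0] := eqVneq f 0.
  by exists 0; apply/eqP; rewrite rmorph0 -(mulIr_eq0 _ (mulIf g0F)) uf f0 rmorph0.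
have val_neq0 (a : A) : a != 0 -> val a != 0.
  by apply: contra_neq => a0; apply: val_inj; rewrite a0 rmorph0.
have [|d Qd fE] := @Q_sat (mlead (val D)) (mlead (val f)) (mlead (val g0)).
  move=> k; have [h hE] := uD k.
  have hD : D * f ^+ k = h * g0 ^+ k.
    apply/eqP; rewrite -(tofrac_eq (D * _)) !tofracM !tofracXn -uf -hE exprMn.
    by rewrite mulrA.
  have h0 : h != 0.
    apply: contra_neq (mulf_neq0 D0 (expf_neq0 k f0)) => h0.
    by rewrite hD h0 mul0r.
  exists (mlead (val h)); first by apply/subalgebra_supp/mlead_supp/val_neq0.
  have := congr1 (fun a : A => mlead (val a)) hD.
  have [nD nf ng nh] := And4 (val_neq0 _ D0) (val_neq0 _ f0) (val_neq0 _ g00) (val_neq0 _ h0).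
  rewrite !vM !vX (mleadM nD (expf_neq0 k nf)) (mleadM nh (expf_neq0 k ng)).
  by rewrite !(mleadX _ nf, mleadX _ ng).
(* Subtracting the quotient [a] of the leading terms from [u] lowers the leading monomial of the
   numerator and keeps [D] and [g0]. *)
have [a aE] := subalgebra_monomial ((val f)@_(mlead (val f)) / (val g0)@_(mlead (val g0))) Qd.
have [nf ng] := conj (val_neq0 _ f0) (val_neq0 _ g00).
set c := _ / _ in aE.
have c0 : c != 0 by rewrite mulf_neq0 ?invr_eq0 ?mleadc_eq0.
have Xa : 'X_[K, d] != 0 by rewrite -msize_poly_eq0 msizeX.
have na : val a != 0 by rewrite aE scaler_eq0 negb_or c0.
have ug : (u - tofrac a) * tofrac g0 = tofrac (f - a * g0).
  by rewrite mulrBl uf tofracB tofracM.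
have uD' := denominator_sub a uD.
have [f'0|f'0] := eqVneq (f - a * g0) 0.
  exists a; apply/eqP; rewrite -subr_eq0 -(mulIr_eq0 _ (mulIf g0F)) ug f'0 rmorph0.
  by [].
have [|b ubE] := IH _ _ (u - tofrac a) (f - a * g0) erefl uD' ug.
  rewrite -E vB vM; apply: mlead_sub_lt.
  - by rewrite (mleadM na ng) aE mleadZ // mleadXm.
  - rewrite (mleadM na ng) mleadcM aE mleadZ // mleadXm mcoeffZ mcoeffX eqxx mulr1.
    by rewrite divfK // mleadc_eq0.
  - by rewrite -vM -vB; apply: val_neq0.
by exists (b + a); rewrite tofracD -ubE subrK.
Qed.

Lemma subalgebra_normal : normal_domain A.
Proof.
move=> u u_int; have [f [g0 [g00 ug]]] := fraction_numden u.
have [D D0 uD] := integral_denominator u_int g00 ug.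
exact: subalgebra_almost_integral D0 g00 uD ug.
Qed.

End MonomialSubalgebra.

(** * The semigroup ring of nested rectangles *)

Section SubalgebraEval.
Context (K : fieldType) (n m : nat) (g : m.-tuple {mpoly K[n]}).

Lemma comp_in_subalgebra (q : {mpoly K[m]}) : q \mPo g \in in_subalgebra g.
Proof. by apply/asboolP; exists q. Qed.

Definition subalgebra_eval q : subalgebra g := Subalgebra (comp_in_subalgebra q).

Lemma val_subalgebra_eval q : val (subalgebra_eval q) = q \mPo g.
Proof. by []. Qed.

Lemma subalgebra_eval_zmod : zmod_morphism subalgebra_eval.
Proof. by move=> p q; apply: val_inj; rewrite rmorphB !val_subalgebra_eval rmorphB. Qed.

Lemma subalgebra_eval_monoid : monoid_morphism subalgebra_eval.
Proof.
split=> [|p q]; apply: val_inj.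
  by rewrite rmorph1 val_subalgebra_eval rmorph1.
by rewrite rmorphM !val_subalgebra_eval rmorphM.
Qed.

HB.instance Definition _ :=
  GRing.isZmodMorphism.Build {mpoly K[m]} (subalgebra g) subalgebra_eval subalgebra_eval_zmod.
HB.instance Definition _ :=
  GRing.isMonoidMorphism.Build {mpoly K[m]} (subalgebra g) subalgebra_eval subalgebra_eval_monoid.

Lemma subalgebra_eval_surj a : exists q, a = subalgebra_eval q.
Proof. by have /asboolP[q aE] := subalgebra_valP a; exists q; apply: val_inj. Qed.

End SubalgebraEval.

(** * Levels of rows and columns of nested rectangles *)

Section Levels.
Local Open Scope nat_scope.
Context (R C N : nat) (S : N.-tuple {set 'I_R * 'I_C}).
Hypothesis hrect : forall k : 'I_N, rectangle (tnth S k).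
Hypothesis hnested : sorted (fun A B : {set 'I_R * 'I_C} => A \proper B)
  (rcons S [set: 'I_R * 'I_C]).

(** In an increasing chain, the first position of a rectangle meeting the row counts those missing
    it; [find] gives [N] if there is none. *)
Definition row_level (i : 'I_R) := find (fun A : {set 'I_R * 'I_C} => [exists j, (i, j) \in A]) S.
Definition col_level (j : 'I_C) := find (fun A : {set 'I_R * 'I_C} => [exists i, (i, j) \in A]) S.

Lemma nested_subset k k' : k <= k' -> k' < N -> nth setT S k \subset nth setT S k'.
Proof.
move=> le_k lt_k'; have sub_tr : transitive (fun A B : {set 'I_R * 'I_C} => A \subset B).
  by move=> B A D; apply: subset_trans.
have : sorted (fun A B : {set 'I_R * 'I_C} => A \subset B) S.
  move: hnested; rewrite -cats1 => /cat_sorted2[+ _]; apply: sub_sorted => A B.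
  exact: proper_sub.
move/(sorted_leq_nth sub_tr (@subxx _ _)) => h; apply: (h setT) => //; rewrite inE size_tuple //.
exact: leq_ltn_trans le_k lt_k'.
Qed.

(** A rectangle is the product of its two projections. *)
Lemma nth_rectangle k c : k < N ->
  (c \in nth setT S k) =
    [exists j, (c.1, j) \in nth setT S k] && [exists i, (i, c.2) \in nth setT S k].
Proof.
move=> lt_k; have [a1 [a2 [b1 [b2 [lt_a lt_b]]]]] := hrect (Ordinal lt_k).
rewrite (tnth_nth setT) /= => ->; case: c => i j; rewrite inE /=.
apply/idP/andP => [ij|[/existsP[j' +] /existsP[i' +]]].
  by split; apply/existsP; [exists j|exists i]; rewrite inE.
by rewrite !inE /= => /andP[-> _] /andP[_ ->].
Qed.

Lemma find_level (P : pred {set 'I_R * 'I_C}) k : k < N ->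
  (forall A B : {set 'I_R * 'I_C}, A \subset B -> P A -> P B) ->
  P (nth setT S k) = (find P S <= k).
Proof.
move=> lt_k Psub; apply/idP/idP => [Pk|le_k].
  by rewrite leqNgt; apply/negP => /(before_find setT); rewrite Pk.
apply: (Psub _ _ (nested_subset le_k lt_k)); apply: nth_find.
by rewrite has_find size_tuple (leq_ltn_trans le_k).
Qed.

Lemma chain_level k c : k <= N ->
  (c \in nth setT S k) = (maxn (row_level c.1) (col_level c.2) <= k).
Proof.
rewrite leq_eqVlt => /predU1P[->|lt_k].
  (* Position [N] is past the end: the default [setT] is S_(N+1), and every level is at most [N]. *)
  rewrite nth_default ?size_tuple // inE geq_max.
  by rewrite -[X in _ <= X](size_tuple S) find_size -[X in _ <= X](size_tuple S) find_size.
rewrite nth_rectangle // geq_max; congr (_ && _).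
  apply: (find_level (P := fun A => [exists j, (c.1, j) \in A]) lt_k) => A B /subsetP AB.
  by case/existsP=> j /AB jB; apply/existsP; exists j.
apply: (find_level (P := fun A => [exists i, (i, c.2) \in A]) lt_k) => A B /subsetP AB.
by case/existsP=> i /AB iB; apply/existsP; exists i.
Qed.

Lemma layer_level c : layer S c = maxn (row_level c.1) (col_level c.2) :> nat.
Proof.
set l := maxn _ _; have lt_l : l < N.+1.
  rewrite ltnS geq_max.
  by rewrite -[X in _ <= X](size_tuple S) find_size -[X in _ <= X](size_tuple S) find_size.
(* [chain S k.+1] is position [k] of [S] and [chain S 0] is empty, so the difference consists of the
   cells of level exactly [k]. *)
have inE' (k : 'I_N.+1) : (c \in chain S k.+1 :\: chain S k) = (k == l :> nat).
  have lt_k := ltn_ord k; rewrite in_setD {2}/chain /= chain_level // -/l.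
  case: k lt_k => -[|k] /= _ lt_k; first by rewrite /chain /= in_set0 leqn0 eq_sym.
  by rewrite /chain /= chain_level -/l; lia.
rewrite /layer; case: pickP => [k|/(_ (Ordinal lt_l))]; rewrite inE' /= ?eqxx //.
by move/eqP.
Qed.

End Levels.

Local Close Scope ring_scope.

Theorem theorem2 (K : fieldType) (R C N : nat)
    (hR : 1 <= R) (hC : 1 <= C) (hN : 1 <= N)
    (S : N.-tuple {set 'I_R * 'I_C})
    (hrect : forall k : 'I_N, rectangle (tnth S k))
    (hnested : sorted (fun A B : {set 'I_R * 'I_C} => A \proper B)
                 (rcons S [set: 'I_R * 'I_C])) :
  [/\ has_quadratic_groebner_basis (@toric_ideal K R C N S),
      has_squarefree_initial_ideal (@toric_ideal K R C N S),
      normal_domain (semigroup_ring K S)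
    & koszul (@semigroup_ring_deg K R C N S)].
Proof.
pose row (k : 'I_#|{: 'I_R * 'I_C}|) := (enum_val k).1.
pose col (k : 'I_#|{: 'I_R * 'I_C}|) := (enum_val k).2.
pose lay (k : 'I_#|{: 'I_R * 'I_C}|) := layer S (enum_val k).
pose cell (i : 'I_R) (j : 'I_C) := enum_rank (i, j).
pose rho := row_level S; pose gam := col_level S.
have row_cell i j : row (cell i j) = i by rewrite /row enum_rankK.
have col_cell i j : col (cell i j) = j by rewrite /col enum_rankK.
have cell_row_col k : cell (row k) (col k) = k.
  by rewrite /cell -surjective_pairing enum_valK.
have layE k : lay k = maxn (rho (row k)) (gam (col k)) :> nat by apply: layer_level.
pose expo := fiber_exp row col lay.
have g_expo q : q \mPo generators K S = relabel expo q.
  rewrite comp_mpolyEX; apply: eq_bigr => m _; congr (_ *: _)%R.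
  rewrite comp_mpolyX -mprodXnE; apply: eq_bigr => k _; congr (_ ^+ _)%R.
  by rewrite tnth_mktuple /= -!mpolyXD.
have [nf nfP] := boolp.choice (standardize row_cell col_cell layE).
have nf_std m : standard row col lay rho gam (nf m) by have [] := nfP m.
have nf_expo m : expo (nf m) = expo m by have [] := nfP m.
have nf_le m : (enc row col rho gam (nf m) <= enc row col rho gam m)%O by have [] := nfP m.
have std_inj := standard_inj cell_row_col layE.
have nf_eq m m' : expo m = expo m' -> nf m = nf m'.
  by move=> E; apply: std_inj; rewrite ?nf_std // -!/(expo _) !nf_expo.
have std_nf m : standard row col lay rho gam m -> nf m = m.
  by move=> std; apply: std_inj; rewrite ?nf_std //; apply: nf_expo.
have nfK m : nf (nf m) = nf m by apply/nf_eq/nf_expo.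
have nfD m1 m2 : nf (nf m1 + m2)%MM = nf (m1 + m2)%MM.
  by apply: nf_eq; rewrite /expo !fiber_expD -!/(expo _) nf_expo.
have mdeg_nf m : mdeg (nf m) = mdeg m.
  apply/eqP; rewrite -(eqn_pmul2l (isT : 0 < 3)).
  by rewrite -!(mdeg_fiber row col lay) -!/(expo _) nf_expo.
have nf_forb (m : 'X_{1..#|{: 'I_R * 'I_C}|}) k k' :
    nf m = m -> 0 < m k -> 0 < m k' -> ~~ forb row col lay rho gam k k'.
  by move=> nfm; have /standardP := nf_std m; rewrite nfm; apply.
have forb_nf (m : 'X_{1..#|{: 'I_R * 'I_C}|}) :
    (forall k k', 0 < m k -> 0 < m k' -> ~~ forb row col lay rho gam k k') -> nf m = m.
  by move=> h; apply/std_nf/standardP.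
(* [nf] and [expo] have the same fibers, so the toric ideal is the kernel of reduction. *)
have ker_nf q : q \mPo generators K S = 0%R <-> relabel nf q = 0%R.
  rewrite g_expo; split; apply: relabel_ker => m m'; try exact: nf_eq.
    by move=> E; rewrite -(nf_expo m) E nf_expo.
  by move=> E; rewrite -(nf_expo m) E nf_expo.
have encD := encD row col rho gam; have enc_inj := @enc_inj _ _ _ row col rho gam.
have f_irr := forb_irr row col lay rho gam.
split.
- by apply: (nf_quadratic_groebner encD enc_inj nfK nf_le mdeg_nf nf_forb forb_nf f_irr).
- by apply: (nf_squarefree_initial encD enc_inj nfK nf_le mdeg_nf nf_forb forb_nf f_irr).
- apply: (subalgebra_normal g_expo (fiber_cone (row := row) (col := col) (lay := lay))).
    by move=> e; apply: (cell_cone_fiber row_cell col_cell layE).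
  exact: cone_saturated.
- apply: (koszul_of_nf encD enc_inj nfK nf_le nfD mdeg_nf nf_forb forb_nf f_irr
    (phi := subalgebra_eval (generators K S))).
  + exact: subalgebra_eval_surj.
  + move=> q; rewrite -ker_nf; split=> [/(congr1 val)|E]; first by rewrite rmorph0.
    by apply: val_inj; rewrite rmorph0.
  + move=> d a; split=> -[q dq aE]; exists q => //; first exact: val_inj.
    by rewrite aE.
Qed.
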